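(* Let $X$ be a centered log-concave random variable, and let $n>2$ be an even integer. Then $$\frac{\lVert X\rVert_{n}}{\lVert X\rVert_{2}}\leq\left(n!\sum_{i=0}^{n}\frac{(-1)^{i}}{i!}\right)^{\frac{1}{n}}=\left(!n\right)^{\frac{1}{n}},$$ with equality if and only if $X$ coincides with $\pm\Gamma$ in law, where $\Gamma$ is a random variable with density $g(x)=e^{-(x+1)}$ supported on $[-1,\infty)$.
   Context: A real random variable $X$ is log-concave if it has a density $f_X$ with respect to Lebesgue measure such that $\log f_X$ is concave on the support of $f_X$; it is centered if $\mathbb{E}[X]=0$. $\|X\|_r=(\mathbb{E}|X|^r)^{1/r}$. $!n$ denotes the subfactorial of $n$.
   Formalization: The equality case is stated up to a positive scale: equality holds iff X coincides in law with ±cΓ for some c > 0, since the ratio is scale invariant and the literal claim fails, e.g. for X = 2Γ. *)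

(* Defs.v *)
From HB Require Import structures.
From mathcomp Require Export all_boot all_order all_algebra perm.
From mathcomp Require Export all_classical all_reals all_analysis measurable_realfun.

Set Implicit Arguments.
Unset Strict Implicit.
Unset Printing Implicit Defensive.

Import Order.TTheory GRing.Theory Num.Theory.
Import numFieldNormedType.Exports.

Local Open Scope classical_set_scope.
Local Open Scope ring_scope.

Definition has_density (R : realType) (d : measure_display)
    (T : measurableType d) (P : probability T R) (X : {RV P >-> R})
    (f : R -> R) : Prop :=
  [/\ measurable_fun [set: R] f,
      forall x, 0 <= f x &
      forall A : set R, measurable A ->
        distribution P X A = (\int[lebesgue_measure]_(x in A) (f x)%:E)%E].

(* The support is taken to be {f > 0}, where log f is finite. A concave function
   has a convex domain, so convexity of the support is part of the notion: it is
   not implied by convex_function, which only tests the inequality at pairs of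
   points of its domain, and ln is 0 outside of ]0, +oo[. *)
Definition log_concave_fun (R : realType) (f : R -> R) : Prop :=
  convex_set (M := R^o) [set x : R | 0 < f x] /\
  convex_function (E := R^o) [set x : R | 0 < f x] (fun x : R => - ln (f x)).

Definition log_concave (R : realType) (d : measure_display)
    (T : measurableType d) (P : probability T R) (X : {RV P >-> R}) : Prop :=
  exists f : R -> R, has_density X f /\ log_concave_fun f.

(* The library's expectation is 0 only for integrable X: if the positive and
   negative parts both have infinite integral, its value is +oo - oo = -oo. *)
Definition centered (R : realType) (d : measure_display)
    (T : measurableType d) (P : probability T R) (X : {RV P >-> R}) : Prop :=
  'E_P[X]%E = 0%E.

(* Laws are compared on measurable sets only: the value of a measure on other
   sets is not specified. *)
Definition eq_law (R : realType) (d d' : measure_display)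
    (T : measurableType d) (T' : measurableType d')
    (P : probability T R) (Q : probability T' R)
    (X : {RV P >-> R}) (Y : {RV Q >-> R}) : Prop :=
  forall A : set R, measurable A -> distribution P X A = distribution Q Y A.

Definition gamma_pdf (R : realType) : R -> R :=
  (fun x : R => expR (- (x + 1))) \_ `[(-1 : R), +oo[.

(* !n, the number of derangements of n points. *)
Definition subfactorial (n : nat) : nat :=
  #|[set s : 'S_n | [forall i, s i != i]]%SET|.

Definition norm_RV (R : realType) (d : measure_display)
    (T : measurableType d) (P : probability T R) (X : {RV P >-> R}) (r : R)
    : \bar R :=
  'N[P]_(r%:E)[EFin \o X]%E.

(* Main.v *)
From mathcomp Require Import ring lra.
From mathcomp Require polyrcf.
Require Import Defs.

(** The third moment of a centered log-concave density f of variance 1 decides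
    which law to compare it with. Replacing X by -X, assume that it is
    nonnegative; call it s. Let xi and xi' be independent with the law of Gamma.

    For f log-concave and ln g affine on an interval, the set where f > g is an
    interval there. Hence f minus the density of Gamma changes sign at most three
    times; as the moments of order 0, 1 and 2 of the difference vanish, its third
    moment is at most 0, and f is the density of Gamma almost everywhere if it
    is 0 (third_moment_le2). So s <= 2.

    If s < 2, there are a >= b > 0 with a ^ 2 + b ^ 2 = 1 such that a xi - b xi' has
    the moments 1, 0, 1, s of f (laplace_third_moment). Its density is exponential
    on each side of its peak, so f minus it changes sign at most four times, and
    the moments of order 0 to 3 of the difference vanish. Since the fourth
    derivative of x ^ n is nonnegative for n even, subtracting from x ^ n the cubic
    that interpolates it at the four sign changes makes the integrand nonpositive:
    E X ^ n <= E (a xi - b xi') ^ n (moment_le_laplace).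

    It remains to see that E (a xi - b xi') ^ n < E xi ^ n, the number of
    derangements of n points. The cumulants explain this: that of order k >= 2 is
    (k - 1)! (a ^ k + (- b) ^ k), at most (k - 1)! in absolute value, and moments are
    polynomials in the cumulants with nonnegative coefficients. The proof below
    compares instead the recursions that the two sequences of moments satisfy
    (laplace_moment_rec, derangementSS, laplace_moment_lt).

    Equality thus holds only if s = 2, that is for Gamma. Around this core,
    log_concave_finite_moments gives the integrability, ge0_integral_density passes
    from random variables to densities, rescale normalizes the variance and the
    sign of the third moment, and card_perm_support counts derangements. *)

Set Implicit Arguments.
Unset Strict Implicit.
Unset Printing Implicit Defensive.

Import Order.TTheory GRing.Theory Num.Theory.
Import numFieldNormedType.Exports.

Local Open Scope classical_set_scope.
Local Open Scope ring_scope.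

(** * Derangement numbers *)

Section derangement_numbers.
Variable R : realType.

Definition derangement (n : nat) : R :=
  n`!%:R * \sum_(0 <= i < n.+1) (-1) ^+ i / i`!%:R.

Lemma derangement0 : derangement 0 = 1.
Proof. by rewrite /derangement big_nat1 fact0 expr0 invr1 !mul1r. Qed.

Lemma derangementS n :
  derangement n.+1 = n.+1%:R * derangement n + (-1) ^+ n.+1.
Proof.
rewrite /derangement big_nat_recr //= mulrDr; congr (_ + _).
  by rewrite factS natrM mulrA.
by rewrite mulrCA divff ?mulr1 // pnatr_eq0 -lt0n fact_gt0.
Qed.

Lemma derangement1 : derangement 1 = 0.
Proof. by rewrite derangementS derangement0 mul1r expr1 subrr. Qed.

(** The signs that the one-term recursion adds at n + 1 and n + 2 cancel. *)
Lemma derangementSS n :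
  derangement n.+2 = n.+1%:R * (derangement n.+1 + derangement n).
Proof. rewrite !derangementS -!natr1 !exprS; ring. Qed.

Lemma derangement_ge0 n : 0 <= derangement n.
Proof.
suff : 0 <= derangement n /\ 0 <= derangement n.+1 by case.
elim: n => [|n [h0 h1]]; first by rewrite derangement0 derangement1.
by rewrite derangementSS; split=> //; rewrite mulr_ge0 // addr_ge0.
Qed.

Lemma derangement_gt0 n : 0 < derangement n.+2.
Proof.
elim: n => [|n ih].
  by rewrite derangementSS derangement1 derangement0 add0r mulr1.
by rewrite derangementSS mulr_gt0 // ltr_wpDr // derangement_ge0.
Qed.

(** Binomial inversion of the definition; the alternating sum that each step of
    the induction leaves over is the expansion of (1 - 1) ^ (n + 1). *)
Lemma sum_binomial_derangement n :
  \sum_(k < n.+1) 'C(n, k)%:R * derangement k = n`!%:R.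
Proof.
elim: n => [|n ih]; first by rewrite big_ord1 bin0 mul1r derangement0 fact0.
rewrite big_ord_recl bin0 mul1r derangement0.
under eq_bigr => i _ do rewrite lift0 derangementS mulrDr mulrA -natrM mulnC.
rewrite big_split /= factS natrM -ih mulr_sumr.
under eq_bigr => i _ do rewrite -mul_bin_diag natrM -mulrA.
rewrite addrCA -[RHS]addr0; congr (_ + _).
have := exprDn (1 : R) (-1) n.+1; rewrite subrr expr0n /= mulr0n big_ord_recl /=.
rewrite bin0 subn0 expr1n expr0 mulr1 mulr1n => {2}->.
by congr (_ + _); apply: eq_bigr => i _; rewrite expr1n mul1r mulr_natl.
Qed.

Lemma sum_subsets_card (T : finType) (A : {set T}) (F : nat -> R) :
  \sum_(B : {set T} | B \subset A) F #|B| = \sum_(k < #|A|.+1) 'C(#|A|, k)%:R * F k.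
Proof.
rewrite (partition_big (fun B : {set T} => inord #|B| : 'I_(#|A|.+1)) predT) //=.
apply: eq_bigr => k _.
transitivity (\sum_(B : {set T} | (B \subset A) && (#|B| == k)) F k); last first.
  rewrite sumr_const mulr_natl -cards_draws.
  by congr (_ *+ _); apply: eq_card => B; rewrite !inE.
apply: eq_big => [B|B].
  case: (boolP (B \subset A)) => //= /subset_leq_card BA.
  by rewrite -val_eqE /= inordK.
by case/andP => /subset_leq_card BA /eqP <-; rewrite inordK.
Qed.

(** Both families of numbers solve the same triangular system: the permutations
    with support inside A number #|A|!, and they split by their exact support. *)
Lemma card_perm_support (T : finType) (A : {set T}) :
  #|[set s : {perm T} | [set x | s x != x]%SET == A]%SET|%:R = derangement #|A|.
Proof.
have [m] := ubnP #|A|; elim: m A => // m ih A; rewrite ltnS => leA.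
set N := fun A : {set T} => #|[set s : {perm T} | [set x | s x != x]%SET == A]%SET|.
have tot : (\sum_(B : {set T} | B \subset A) N B = (#|A|)`!)%N.
  rewrite -card_perm -sum1_card.
  rewrite (partition_big (fun s : {perm T} => [set x | s x != x]%SET)
    (fun B => B \subset A)) /=; last first.
    move=> s /fintype.subsetP sA; apply/fintype.subsetP => x; rewrite inE => h.
    by apply: sA; rewrite inE.
  apply: eq_bigr => B BA; rewrite /N -sum1_card; apply: eq_bigl => s.
  rewrite !inE; case: eqP => [e|]; rewrite ?andbF ?andbT //.
  apply/esym/fintype.subsetP => x; rewrite inE => h.
  by apply: (fintype.subsetP BA); rewrite -e inE.
have /(congr1 (fun k => k%:R : R)) := tot.
rewrite -sum_binomial_derangement -sum_subsets_card natr_sum.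
rewrite (bigD1 A) //= [RHS](bigD1 A) //= => e; apply: (addIr _ (etrans e _)).
congr (_ + _); apply: eq_bigr => B /andP[BA BnA]; rewrite -ih //.
by rewrite (leq_trans _ leA) // proper_card // finset.properEneq BnA.
Qed.

Lemma subfactorialE n : (subfactorial n)%:R = derangement n.
Proof.
rewrite -[in RHS](card_ord n) -cardsT -card_perm_support /subfactorial.
congr (_%:R); apply: eq_card => s; rewrite !inE -finset.subTset.
apply/forallP/fintype.subsetP => [h x _|h x]; first by rewrite inE h.
by have := h x; rewrite !inE => /(_ isT).
Qed.
End derangement_numbers.

(** * Divided differences of polynomials *)

Section divided_differences.
Variable R : realType.
Implicit Types (p q r : {poly R}) (a x : R).

(** Mean value theorem for (x - a) ^ k.+1 r, which vanishes at a and whose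
    derivative is (x - a) ^ k times the polynomial of the hypothesis. *)
Lemma poly_euler_ge0 (k : nat) a r :
  (forall x, 0 <= (('X - a%:P) * r^`() + r *+ k.+1).[x]) -> forall x, 0 <= r.[x].
Proof.
move=> h x; pose E := ('X - a%:P) * r^`() + r *+ k.+1.
pose g := ('X - a%:P) ^+ k.+1 * r.
have dg : g^`() = ('X - a%:P) ^+ k * E.
  rewrite /g /E derivM deriv_exp derivXsubC mul1r /=.
  by rewrite mulrDr mulrnAl mulrnAr addrC exprSr mulrA.
have gE y : g.[y] = (y - a) ^+ k.+1 * r.[y] by rewrite /g !hornerE.
have ga : g.[a] = 0 by rewrite gE subrr exprS !mul0r.
have [xa|xa] := eqVneq x a.
  by have := h x; rewrite xa !hornerE subrr mul0r add0r hornerMn pmulrn_lge0.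
have [c [c0 gc]] : exists c, 0 <= (c - a) / (x - a) /\ g.[x] = g^`().[c] * (x - a).
  case: (ltgtP a x) xa => [ax _|xa' _|//].
  + have [c /itvP ca e] := polyrcf.poly_mvt g ax.
    exists c; rewrite -e ga subr0; split=> //.
    by rewrite divr_ge0 // subr_ge0 ?ca // ltW.
  + have [c /itvP ca e] := polyrcf.poly_mvt g xa'.
    exists c; rewrite -(opprB a x) mulrN -e ga sub0r opprK; split=> //.
    by rewrite -mulrNN -invrN !opprB divr_ge0 // subr_ge0 ?ca // ltW.
have xa0 : x - a != 0 by rewrite subr_eq0.
suff -> : r.[x] = ((c - a) / (x - a)) ^+ k * E.[c] by rewrite mulr_ge0 ?exprn_ge0.
apply: (mulfI (expf_neq0 k.+1 xa0)).
rewrite -gE gc dg hornerM horner_exp hornerXsubC exprMn exprVn.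
by rewrite exprS; field; rewrite expf_neq0.
Qed.

Lemma derivnM_XsubC k a q :
  (('X - a%:P) * q)^`(k.+1) = ('X - a%:P) * q^`(k.+1) + q^`(k) *+ k.+1.
Proof.
elim: k => [|k ih].
  by rewrite !derivn1 derivM derivXsubC mul1r addrC derivn0 mulr1n.
rewrite derivnS ih derivD derivM derivXsubC mul1r -derivnS addrAC.
by rewrite derivMn -derivnS [RHS]addrC [in RHS]mulrS -addrA addrC.
Qed.

(** The divided difference of order m of p is an average of its m-th derivative;
    here it is the quotient of p by the product of the X - c. *)
Lemma divided_difference_ge0 (s : seq R) p :
  (forall x, 0 <= p^`(size s).[x]) ->
  exists q r, [/\ p = q * \prod_(c <- s) ('X - c%:P) + r,
    forall x, 0 <= q.[x] & (size r <= size s)%N].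
Proof.
elim: s p => [|a s ih] p hp.
  by exists p, 0; rewrite big_nil mulr1 addr0 size_poly0.
have /factor_theorem[q1 e1] : root (p - p.[a]%:P) a.
  by rewrite /root !hornerE subrr.
have e : p = ('X - a%:P) * q1 + p.[a]%:P by rewrite mulrC -e1 subrK.
have [] := ih q1.
  apply: (@poly_euler_ge0 (size s) a) => x; have := hp x.
  rewrite [in p^`(_)]e derivnD derivnC /= addr0.
  by rewrite -derivnS -derivnM_XsubC.
move=> q [r [eq q0 sr]]; exists q, (('X - a%:P) * r + p.[a]%:P); split=> //.
  by rewrite big_cons [in LHS]e eq; ring.
rewrite (leq_trans (size_polyD _ _)) // geq_max (leq_trans (size_polyMleq _ _)).
  by rewrite (leq_trans (size_polyC_leq1 _)).
by rewrite size_XsubC.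
Qed.

Lemma even_power_derivn_ge0 n m x : ~~ odd n -> ~~ odd m ->
  0 <= ('X^n : {poly R})^`(m).[x].
Proof.
move=> on om; rewrite derivnXn hornerMn hornerXn mulrn_wge0 //.
have [mn|mn] := leqP m n; last first.
  by rewrite (_ : n - m = 0)%N //; apply/eqP; rewrite subn_eq0 ltnW.
by rewrite exprn_even_ge0 // oddB // (negbTE on) (negbTE om).
Qed.

End divided_differences.

(** * Polynomials changing sign at the ends of an interval *)

Section sign_polynomials.
Variable R : realType.
Implicit Types (I : set R) (q : {poly R}) (x c d : R).

(** Products of two such polynomials either have degree at most 3 or are products
    of four factors X - c. *)
Definition linear_or_split q :=
  (size q <= 2)%N \/ exists c d, q = ('X - c%:P) * ('X - d%:P).

(** The roots are the finite ends of I, so q is constant, linear or quadratic. *)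
Lemma interval_sign_poly_right I x0 : is_interval I -> (forall x, I x -> x0 <= x) ->
  exists q, [/\ q != 0, linear_or_split q, forall x, I x -> q.[x] <= 0,
    forall x, ~ I x -> 0 <= q.[x] & forall x, x <= x0 -> 0 <= q.[x]].
Proof.
move=> itvI lbI.
have [[y Iy]|I0] := pselect (I !=set0); last first.
  exists 1; split=> [|| x Ix | x _ | x _]; rewrite ?hornerC ?oner_neq0 //.
  - by left; rewrite size_poly1.
  - by case: I0; exists x.
have hlb : has_lbound I by exists x0.
have hinf : has_inf I by split => //; exists y.
have x0c : x0 <= inf I by apply: lb_le_inf; [exists y|].
have cI x : I x -> inf I <= x by move=> Ix; apply: ge_inf.
have below x : inf I < x -> exists2 z, I z & z < x.
  by apply: inf_lt; exists y.
have [hub|nub] := pselect (has_ubound I).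
  have Id x : I x -> x <= sup I by move=> Ix; apply: ub_le_sup.
  exists (('X - (inf I)%:P) * ('X - (sup I)%:P)); split.
  - by rewrite mulf_neq0 // polyXsubC_eq0.
  - by right; exists (inf I), (sup I).
  - move=> x Ix; rewrite !hornerE mulr_ge0_le0 ?subr_ge0 ?subr_le0 //.
      exact: cI.
    exact: Id.
  - move=> x nIx; rewrite !hornerE leNgt; apply/negP => neg.
    have xc : inf I < x < sup I.
      have := le_trans (cI _ Iy) (Id _ Iy); nra.
    case/andP: xc => /below[z Iz zx].
    move=> /(sup_gt (ex_intro _ y Iy))[w Iw xw].
    by apply: nIx; apply: (itvI z w) => //; rewrite (ltW zx) (ltW xw).
  - move=> x xx0; rewrite !hornerE.
    have := le_trans (cI _ Iy) (Id _ Iy); nra.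
exists ((inf I)%:P - 'X); split.
- by rewrite -opprB oppr_eq0 polyXsubC_eq0.
- by left; rewrite -opprB size_polyN size_XsubC.
- by move=> x Ix; rewrite !hornerE subr_le0 cI.
- move=> x nIx; rewrite !hornerE subr_ge0 leNgt; apply/negP => /below[z Iz zx].
  apply: nub; exists x => w Iw; rewrite leNgt; apply/negP => xw.
  by apply: nIx; apply: (itvI z w) => //; rewrite (ltW zx) (ltW xw).
- by move=> x xx0; rewrite !hornerE subr_ge0 (le_trans xx0).
Qed.

Lemma interval_sign_poly_left I x0 : is_interval I -> (forall x, I x -> x <= x0) ->
  exists q, [/\ q != 0, linear_or_split q, forall x, I x -> q.[x] <= 0,
    forall x, ~ I x -> 0 <= q.[x] & forall x, x0 <= x -> 0 <= q.[x]].
Proof.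
move=> itvI ubI; pose J := [set x | I (- x)].
have [||q [q0 qs qI qnI qx0]] := @interval_sign_poly_right J (- x0).
- move=> x y Jx Jy z /andP[xz zy]; apply: (itvI (- y) (- x)) => //.
  by rewrite !lerN2 xz zy.
- by move=> x /ubI; rewrite lerNl.
have qE x : (q \Po - 'X).[x] = q.[- x] by rewrite horner_comp !hornerE.
exists (q \Po - 'X); split.
- by rewrite comp_poly2_eq0 // size_polyN size_polyX.
- case: qs => [qs|[c [d ->]]]; [left|right].
    by rewrite size_comp_poly2 // size_polyN size_polyX.
  exists (- c), (- d); rewrite rmorphM /= !comp_polyB !comp_polyX !comp_polyC !polyCN; ring.
- by move=> x Ix; rewrite qE qI // /J /= opprK.
- by move=> x nIx; rewrite qE qnI // /J /= opprK.
- by move=> x xx0; rewrite qE qx0 // lerN2.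
Qed.

End sign_polynomials.

(** * Integrals of polynomials against a function with finite moments *)

Section moments.
Variable R : realType.
Implicit Types (f g h : R -> R) (p q r : {poly R}) (m k : nat).
Local Notation mu := (@lebesgue_measure R).

Definition finite_moments f :=
  forall k, mu.-integrable [set: R] (EFin \o (fun x => x ^+ k * f x)).

Definition moment f p : R := \int[mu]_x (p.[x] * f x).

Lemma integrable_poly f p : finite_moments f ->
  mu.-integrable [set: R] (EFin \o (fun x => p.[x] * f x)).
Proof.
move=> fm.
suff : forall k, mu.-integrable [set: R] (EFin \o (fun x => x ^+ k * (p.[x] * f x))).
  by move=> /(_ 0); apply: eq_integrable => // x _ /=; rewrite expr0 mul1r.
elim/poly_ind: p => [|p c ih] k.
  by apply: eq_integrable (integrable0 _ _) => // x _ /=; rewrite horner0 mul0r mulr0.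
apply: eq_integrable (integrableD _ (ih k.+1) (integrableZl _ c (fm k))) => // x _ /=.
rewrite -EFinM -EFinD hornerMXaddC exprS mulrDl mulrDr; congr ((_ + _)%:E).
  by rewrite -!mulrA mulrCA; congr (_ * _); rewrite mulrCA.
by rewrite mulrCA.
Qed.

Lemma finite_momentsB f g : finite_moments f -> finite_moments g ->
  finite_moments (fun x => f x - g x).
Proof.
move=> fm gm k; apply: eq_integrable (integrableB _ (fm k) (gm k)) => // x _ /=.
by rewrite -EFinB mulrBr.
Qed.

Lemma momentD f p q : finite_moments f -> moment f (p + q) = moment f p + moment f q.
Proof.
move=> fm; rewrite /moment -RintegralD //; try exact: integrable_poly.
by apply: eq_Rintegral => x _; rewrite hornerD mulrDl.
Qed.

Lemma momentZ f a p : finite_moments f -> moment f (a *: p) = a * moment f p.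
Proof.
move=> fm; rewrite /moment -RintegralZl //; last exact: integrable_poly.
by apply: eq_Rintegral => x _; rewrite hornerZ mulrA.
Qed.

Lemma moment_sum f n (F : nat -> {poly R}) : finite_moments f ->
  moment f (\sum_(i < n) F i) = \sum_(i < n) moment f (F i).
Proof.
move=> fm; elim: n => [|n ih]; last by rewrite !big_ord_recr /= momentD // ih.
by rewrite !big_ord0 -(scale0r 0) momentZ // mul0r.
Qed.

Lemma moment_coef f p : finite_moments f ->
  moment f p = \sum_(i < size p) p`_i * moment f 'X^i.
Proof.
move=> fm; rewrite -[in LHS](coefK p) poly_def (moment_sum _ (fun i => p`_i *: 'X^i)) //.
by apply: eq_bigr => i _; rewrite momentZ.
Qed.

Lemma momentB f g p : finite_moments f -> finite_moments g ->
  moment (fun x => f x - g x) p = moment f p - moment g p.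
Proof.
move=> fm gm; rewrite /moment -RintegralB //; try exact: integrable_poly.
by apply: eq_Rintegral => x _; rewrite mulrBr.
Qed.

Lemma moment_eq0_small h m p : finite_moments h ->
  (forall k, (k < m)%N -> moment h 'X^k = 0) -> (size p <= m)%N -> moment h p = 0.
Proof.
move=> hm h0 sp; rewrite moment_coef // big1 // => i _.
by rewrite h0 ?mulr0 // (leq_trans _ sp).
Qed.

(** A nonpositive function with zero integral vanishes almost everywhere, and Q
    has finitely many roots. *)
Lemma ae_eq0_of_moment_eq0 h Q : finite_moments h -> Q != 0 ->
  (forall x, Q.[x] * h x <= 0) -> moment h Q = 0 -> {ae mu, forall x, h x = 0}.
Proof.
move=> hm Q0 Qh h0.
have iQ := integrable_poly Q hm.
have : ae_eq mu [set: R] (EFin \o (fun x => Q.[x] * h x)) (cst 0%E).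
  apply/ae_eq_integral_abs => //; first exact: measurable_int iQ.
  under eq_integral => x _ do rewrite /= ler0_norm // EFinN.
  rewrite (_ : (fun x => _) = -%E \o (EFin \o (fun x => Q.[x] * h x))) //.
  rewrite integralN /=; last exact: integrable_add_def.
  have /fineK <- := integrable_fin_num measurableT iQ.
  by rewrite [fine _]h0 oppe0.
have nQ : {ae mu, forall x, Q.[x] != 0}.
  have cr : countable [set` polyrcf.rootsR Q] by apply: finite_set_countable.
  apply: (@negligibleS _ _ _ mu [set` polyrcf.rootsR Q]).
    move=> x /= /negP; rewrite negbK => /eqP Qx.
    by rewrite -(polyrcf.roots_on_rootsR Q0) in_itv /=; apply/eqP.
  apply/negligibleP; first exact: countable_measurable.
  exact: countable_lebesgue_measure0.
move=> Qh0; apply: (negligibleS _ (negligibleU nQ Qh0)) => x /= hx.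
have [Qx|Qx] := eqVneq Q.[x] 0; [by left|right].
by move=> /(_ I) [] /eqP; rewrite mulf_eq0 (negbTE Qx) => /eqP.
Qed.

Lemma moment_mul_le0 h q Q : finite_moments h ->
  (forall x, 0 <= q.[x]) -> (forall x, Q.[x] * h x <= 0) -> moment h (q * Q) <= 0.
Proof.
move=> hm q0 Qh; rewrite -oppr_ge0 -mulN1r -momentZ //; apply: Rintegral_ge0 => x _.
by rewrite hornerZ hornerM mulN1r mulNr oppr_ge0 -mulrA mulr_ge0_le0.
Qed.

End moments.

(** * Affine changes of variables for the Lebesgue measure *)

Section affine_change.
Variable R : realType.
Implicit Types (c d : R) (F : R -> R).
Local Notation mu := (@lebesgue_measure R).

Definition affine c d : measurableTypeR R -> measurableTypeR R := fun y => d + c * y.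

Lemma measurable_affine c d : measurable_fun [set: measurableTypeR R] (affine c d).
Proof. by apply: measurable_funD => //; exact: measurable_funM. Qed.

Lemma lebesgue_measure_affine c d (A : set (measurableTypeR R)) : c != 0 -> measurable A ->
  mu A = (`|c|%:E * mu (affine c d @^-1` A))%E.
Proof.
move=> c0 mA; pose phi := affine c d.
have mphi : measurable_fun setT phi by exact: measurable_affine.
pose phi_mixin := isMeasurableFun.Build _ _ _ _ _ mphi.
pose mphi_pack := MeasurableFun.Pack (MeasurableFun.Class phi_mixin).
apply: (@lebesgue_measure_unique R
  (mscale (NngNum (normr_ge0 c)) (pushforward mu mphi_pack))) => // _ [[a b]] _ <-.
change (mu `]a, b]%classic = (`|c|%:E * mu (phi @^-1` `]a, b]%classic))%E).
have scale l u : l = a - d -> u = b - d -> 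
    (`|c|%:E * (if (l < u)%R then (u / `|c|)%R%:E - (l / `|c|)%R%:E else 0))%E =
    (if (a < b)%R then b%:E - a%:E else 0)%E.
  move=> -> ->; rewrite ltrD2r; case: ifP => _; last by rewrite mule0.
  by rewrite -!EFinB -EFinM; congr (_%:E); field; rewrite normr_eq0.
have [cp|cn|/eqP] := ltrgtP 0 c; last by rewrite eq_sym (negbTE c0).
- have -> : phi @^-1` `]a, b] = `](a - d) / c, (b - d) / c]%classic.
    by apply/seteqP; split=> x /=;
      rewrite !in_itv /= /phi /affine ltr_pdivrMr // ler_pdivlMr // => /andP[h1 h2];
      apply/andP; split; lra.
  rewrite !lebesgue_measure_itv /= !lte_fin ltr_pM2r ?invr_gt0 //.
  by rewrite -(scale (a - d) (b - d)) // gtr0_norm.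
- have -> : phi @^-1` `]a, b] = `[(b - d) / c, (a - d) / c[%classic.
    by apply/seteqP; split=> x /=;
      rewrite !in_itv /= /phi /affine ltr_ndivlMr // ler_ndivrMr // => /andP[h1 h2];
      apply/andP; split; lra.
  rewrite !lebesgue_measure_itv /= !lte_fin ltr_nM2r ?invr_lt0 //.
  rewrite -(scale (a - d) (b - d)) // ltr0_norm // invrN !mulrN.
  by case: ifP => // _; rewrite -!EFinB opprK addrC.
Qed.

Lemma ge0_integral_affine c d (F : R -> \bar R) : c != 0 ->
  measurable_fun [set: R] F -> (forall x, 0 <= F x)%E ->
  (\int[mu]_x F x = `|c|%:E * \int[mu]_y F (d + c * y)%R)%E.
Proof.
move=> c0 mF F0; pose phi := affine c d.
have mphi : measurable_fun setT phi by exact: measurable_affine.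
pose phi_mixin := isMeasurableFun.Build _ _ _ _ _ mphi.
pose mphi_pack := MeasurableFun.Pack (MeasurableFun.Class phi_mixin).
rewrite (@eq_measure_integral _ _ _ _
  (mscale (NngNum (normr_ge0 c)) (pushforward mu mphi_pack))) /=; last first.
  by move=> A mA _; rewrite (lebesgue_measure_affine d c0).
by rewrite ge0_integral_mscale // ge0_integral_pushforward.
Qed.

Lemma integrable_affine c d F : c != 0 -> measurable_fun [set: R] F ->
  mu.-integrable [set: R] (EFin \o (fun y => F (d + c * y))) ->
  mu.-integrable [set: R] (EFin \o F).
Proof.
move=> c0 mF /integrableP[_ iG]; apply/integrableP; split; first exact/measurable_EFinP.
rewrite (ge0_integral_affine d c0) //; first by rewrite lte_mul_pinfty.
by apply/measurable_EFinP; exact: measurableT_comp.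
Qed.

Lemma Rintegral_affine c d F : c != 0 -> measurable_fun [set: R] F ->
  mu.-integrable [set: R] (EFin \o (fun y => F (d + c * y))) ->
  \int[mu]_x F x = `|c| * \int[mu]_y F (d + c * y).
Proof.
move=> c0 mF iG; pose FE := EFin \o F.
have mFE : measurable_fun [set: R] FE by exact/measurable_EFinP.
have GE : EFin \o (fun y => F (d + c * y)) = FE \o affine c d by [].
rewrite /Rintegral -(fineK (integrable_fin_num _ iG)) // [X in _ = _ * X]/=.
rewrite -[RHS]/(fine (_ * _)%:E); congr fine.
rewrite EFinM (fineK (integrable_fin_num _ iG)) //.
rewrite GE -[LHS]/(\int[mu]_x FE x)%E [LHS]integralE [in RHS]integralE muleBr //; last first.
  by rewrite -GE; exact: integrable_add_def.
rewrite (funepos_comp FE (affine c d)) (funeneg_comp FE (affine c d)).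
congr (_ - _)%E; apply: ge0_integral_affine => //.
  exact: measurable_funepos.
exact: measurable_funeneg.
Qed.

End affine_change.

(** * Moments of the exponential distribution *)

Section exponential_moments.
Variable R : realType.
Implicit Types (c d x y : R) (p : {poly R}).
Local Notation mu := (@lebesgue_measure R).

Definition exp_pdf : R -> R := (fun y : R => expR (- y)) \_ `[0, +oo[.

Lemma exp_pdfE y : 0 <= y -> exp_pdf y = expR (- y).
Proof. by move=> y0; rewrite /exp_pdf patchE ifT // inE /= in_itv /= y0. Qed.

Lemma exp_pdf_lt0 y : y < 0 -> exp_pdf y = 0.
Proof.
by move=> y0; rewrite /exp_pdf patchE ifF // memNset //= in_itv /= andbT leNgt y0.
Qed.

Lemma exp_pdf_ge0 y : 0 <= exp_pdf y.
Proof. by have [y0|/exp_pdf_lt0->//] := leP 0 y; rewrite exp_pdfE // expR_ge0. Qed.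

Lemma measurable_exp_pdf : measurable_fun [set: R] exp_pdf.
Proof.
apply/measurable_restrict => //; apply: measurable_funTS.
by apply: measurableT_comp => //; exact: measurable_expR.
Qed.

Lemma cvg_power_expN k : y ^+ k * expR (- y) @[y --> +oo] --> (0 : R).
Proof.
apply: (@squeeze_cvgr _ _ _ _ (cst 0) (fun y => k.+1`!%:R * y^-1)).
- near=> y; have y0 : 0 < y by near: y; exact: nbhs_pinfty_gt.
  have f0 : (0 : R) < k.+1`!%:R by rewrite ltr0n fact_gt0.
  apply/andP; split; first by rewrite mulr_ge0 ?exprn_ge0 ?expR_ge0 ?ltW.
  rewrite expRN ler_pdivrMr ?expR_gt0 // mulrAC ler_pdivlMr // -exprSr.
  rewrite -ler_pdivrMl // mulrC (le_trans _ (expR_ge1Dxn k (ltW y0))) //.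
  by rewrite lerDr.
- exact: cvg_cst.
- rewrite -[X in _ --> X](mulr0 (k.+1`!%:R : R)); apply: cvgM; first exact: cvg_cst.
  by apply/gtr0_cvgV0; [near=> y; near: y; exact: nbhs_pinfty_gt | exact: cvg_id].
Unshelve. all: by end_near. Qed.

Lemma cvg_horner_expN p : p.[y] * expR (- y) @[y --> +oo] --> (0 : R).
Proof.
suff : forall k, y ^+ k * p.[y] * expR (- y) @[y --> +oo] --> (0 : R).
  by move=> /(_ 0%N); under eq_cvg do rewrite expr0 mul1r.
elim/poly_ind: p => [|p c ih] k.
  by under eq_cvg do rewrite horner0 mulr0 mul0r; exact: cvg_cst.
rewrite (_ : (fun y => _) =
  (fun y => y ^+ k.+1 * p.[y] * expR (- y) + c * (y ^+ k * expR (- y)))); last first.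
  by apply/funext => y; rewrite hornerMXaddC exprS; ring.
rewrite -[X in _ --> X]addr0; apply: cvgD; first exact: ih.
rewrite -[X in _ --> X](mulr0 c); apply: cvgM; first exact: cvg_cst.
exact: cvg_power_expN.
Qed.

Lemma is_derive_poly_expN p x :
  is_derive x 1 (fun y => - (p.[y] * expR (- y))) ((p - p^`()).[x] * expR (- x)).
Proof.
have dp : is_derive x 1 (horner p) p^`().[x].
  by apply: DeriveDef; [exact: derivable_horner|rewrite derivE derive1E].
have de : is_derive x 1 (fun y => expR (- y)) (- expR (- x)).
  by apply: is_derive_eq (is_derive1_comp _ _) _; rewrite mulrN1.
apply: is_derive_eq (is_deriveN (is_deriveM dp de)) _.
by rewrite /GRing.scale /= hornerD hornerN; ring.
Qed.

(** A primitive of (p - p') exp(-y) is - p exp(-y). *)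
Lemma integral_poly_exp p : (forall y, 0 <= y -> 0 <= (p - p^`()).[y]) ->
  (\int[mu]_(y in `[0%R, +oo[) ((p - p^`()).[y] * expR (- y))%:E = p.[0]%:E)%E.
Proof.
move=> pp.
pose F (y : R) := - (p.[y] * expR (- y)).
have cF x : {for x, continuous F}.
  apply: differentiable_continuous; apply/derivable1_diffP.
  by have [] := is_derive_poly_expN p x.
rewrite (@ge0_continuous_FTC2y _ _ F _ 0).
- by rewrite /F oppr0 expR0 mulr1 sub0e -EFinN opprK.
- by move=> x x0; rewrite mulr_ge0 ?expR_ge0 // pp.
- apply: continuous_subspaceT => x; apply: cvgM; first exact: continuous_horner.
  apply: continuous_comp; [exact: cvgN|exact: continuous_expR].
- by rewrite -oppr0; apply: cvgN; exact: cvg_horner_expN.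
- by move=> x _; have [] := is_derive_poly_expN p x.
- by apply: cvg_at_right_filter; exact: cF.
- by move=> x _; rewrite derive1E; have [_ ->] := is_derive_poly_expN p x.
Qed.


Lemma exp_primitive k : exists2 p : {poly R}, p - p^`() = 'X^k & p.[0] = k`!%:R.
Proof.
elim: k => [|k [p pk p0]].
  by exists 1; [rewrite derivC subr0 expr0|rewrite hornerC fact0].
exists ('X^(k.+1) + k.+1%:R *: p).
  rewrite derivD derivZ derivXn opprD addrACA -scalerBr pk /= scaler_nat.
  by rewrite -addrA addNr addr0.
by rewrite hornerD hornerZ hornerXn expr0n /= mulr0n add0r p0 factS natrM.
Qed.

Lemma integral_power_exp k :
  (\int[mu]_y (y ^+ k * exp_pdf y)%:E = (k`!%:R)%:E)%E.
Proof.
have [p pk <-] := exp_primitive k.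
rewrite -integral_poly_exp; last by move=> y y0; rewrite pk hornerXn exprn_ge0.
rewrite [RHS]integral_mkcond; apply: eq_integral => y _.
rewrite patchE mem_setE in_itv /= andbT pk hornerXn.
case: leP => [y0|y0]; first by rewrite exp_pdfE.
by rewrite exp_pdf_lt0 // mulr0.
Qed.

Lemma finite_moments_exp : finite_moments exp_pdf.
Proof.
move=> k; have mf : measurable_fun [set: R] (fun y => y ^+ k * exp_pdf y).
  by apply: measurable_funM; [exact: measurable_funX|exact: measurable_exp_pdf].
apply/integrableP; split; first exact/measurable_EFinP.
under eq_integral => y _.
  rewrite /= ger0_norm; last first.
    have [y0|y0] := leP 0 y; first by rewrite mulr_ge0 ?exp_pdf_ge0 ?exprn_ge0.
    by rewrite exp_pdf_lt0 // mulr0.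
  over.
by rewrite integral_power_exp ltry.
Qed.

Lemma moment_exp_power k : moment exp_pdf 'X^k = k`!%:R.
Proof.
rewrite /moment /Rintegral; under eq_integral do rewrite hornerXn.
by rewrite integral_power_exp.
Qed.

(** Integration by parts, checked on monomials. *)
Lemma moment_exp_deriv p : moment exp_pdf p = p.[0] + moment exp_pdf p^`().
Proof.
have fm := finite_moments_exp.
rewrite -[in p^`()](coefK p) poly_def raddf_sum /=.
rewrite (moment_sum _ (fun i => (p`_i *: 'X^i)^`())) // horner_coef moment_coef //.
rewrite -big_split; apply: eq_bigr => -[i _] _ /=.
rewrite derivZ momentZ // -mulrDr moment_exp_power derivXn -(scaler_nat i) momentZ //.
rewrite moment_exp_power; congr (_ * _).
by case: i => [|i] /=; rewrite ?expr0 ?fact0 ?mul0r ?addr0 // exprS mul0r add0r factS natrM.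
Qed.

(** The exponential density rescaled by c and started at d; for c < 0 it lives on
    the left of d. *)
Definition exp_side c d x : R := exp_pdf ((x - d) / c).

Lemma exp_side_ge0 c d x : 0 <= exp_side c d x.
Proof. exact: exp_pdf_ge0. Qed.

Lemma measurable_exp_side c d : measurable_fun [set: R] (exp_side c d).
Proof.
apply: measurableT_comp; first exact: measurable_exp_pdf.
by apply: measurable_funM => //; exact: measurable_funB.
Qed.

Lemma exp_side_affine c d y : c != 0 -> exp_side c d (d + c * y) = exp_pdf y.
Proof. by move=> c0; rewrite /exp_side addrC addKr mulrC mulKf. Qed.

Lemma measurable_horner_mul p (f : R -> R) :
  measurable_fun [set: R] f -> measurable_fun [set: R] (fun x => p.[x] * f x).
Proof.
move=> mf; apply: measurable_funM => //; apply: continuous_measurable_fun.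
exact: continuous_horner.
Qed.

Lemma integrable_exp_side_affine p c d : c != 0 ->
  mu.-integrable [set: R]
    (EFin \o (fun y => p.[d + c * y] * exp_side c d (d + c * y))).
Proof.
move=> c0; have := integrable_poly (p \Po (d%:P + c *: 'X)) finite_moments_exp.
apply: eq_integrable => // y _ /=.
by rewrite exp_side_affine // horner_comp hornerD hornerC hornerZ hornerX.
Qed.

Lemma finite_moments_exp_side c d : c != 0 -> finite_moments (exp_side c d).
Proof.
move=> c0 k.
have E : (fun x => x ^+ k * exp_side c d x) = (fun x => ('X^k).[x] * exp_side c d x).
  by apply/funext => x; rewrite hornerXn.
rewrite E; apply: (integrable_affine (d := d) c0).
  by apply: measurable_horner_mul; exact: measurable_exp_side.
exact: integrable_exp_side_affine.
Qed.

Lemma moment_exp_sideE c d p : c != 0 ->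
  moment (exp_side c d) p = `|c| * moment exp_pdf (p \Po (d%:P + c *: 'X)).
Proof.
move=> c0; rewrite /moment (@Rintegral_affine R c d (fun x => p.[x] * exp_side c d x) c0).
- congr (_ * _); apply: eq_Rintegral => y _.
  by rewrite exp_side_affine // horner_comp hornerD hornerC hornerZ hornerX.
- by apply: measurable_horner_mul; exact: measurable_exp_side.
- exact: integrable_exp_side_affine.
Qed.

Lemma moment_exp_side_deriv c d p : c != 0 ->
  moment (exp_side c d) p = `|c| * p.[d] + c * moment (exp_side c d) p^`().
Proof.
move=> c0; rewrite !moment_exp_sideE // moment_exp_deriv mulrDr.
have fm := finite_moments_exp.
rewrite horner_comp hornerD hornerC hornerZ hornerX mulr0 addr0; congr (_ + _).
rewrite deriv_comp derivD derivC derivZ derivX add0r -scalerAr mulr1.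
by rewrite momentZ // mulrCA.
Qed.

Lemma moment_exp_side_power c d n : c != 0 ->
  moment (exp_side c d) 'X^(n.+1) =
    `|c| * d ^+ n.+1 + c * n.+1%:R * moment (exp_side c d) 'X^n.
Proof.
move=> c0; rewrite moment_exp_side_deriv // hornerXn derivXn -(scaler_nat n.+1).
by rewrite momentZ ?mulrA //; exact: finite_moments_exp_side.
Qed.

Lemma moment_exp_side0 c d : c != 0 -> moment (exp_side c d) 1 = `|c|.
Proof.
move=> c0; rewrite moment_exp_sideE // -polyC1 comp_polyC polyC1.
by rewrite -(expr0 'X) moment_exp_power fact0 mulr1.
Qed.

End exponential_moments.

(** * The extremal laws and their moments *)

Section comparison_densities.
Variable R : realType.
Implicit Types (a b c d x s : R) (p : {poly R}).
Local Notation mu := (@lebesgue_measure R).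

Lemma gamma_pdfE : @gamma_pdf R = exp_side 1 (-1).
Proof.
apply/funext => x; rewrite /gamma_pdf /exp_side opprK divr1 patchE mem_setE in_itv /= andbT.
case: leP => x1; first by rewrite exp_pdfE // -lerBlDr sub0r.
by rewrite exp_pdf_lt0 // -ltrBrDr sub0r.
Qed.

Lemma finite_moments_gamma : finite_moments (@gamma_pdf R).
Proof. by rewrite gamma_pdfE; apply: finite_moments_exp_side; rewrite oner_neq0. Qed.

Lemma moment_gamma n : moment (@gamma_pdf R) 'X^n = derangement R n.
Proof.
have n0 : (1 : R) != 0 by rewrite oner_neq0.
rewrite gamma_pdfE; elim: n => [|n ih].
  by rewrite expr0 moment_exp_side0 // normr1 derangement0.
by rewrite moment_exp_side_power // normr1 !mul1r ih addrC derangementS.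
Qed.

(** The density of a (E - 1) - b (E' - 1) for independent standard exponential
    variables E and E', except that its value at the peak b - a is doubled. *)
Definition laplace_pdf a b x : R :=
  (a + b)^-1 * (exp_side a (b - a) x + exp_side (- b) (b - a) x).

Section laplace.
Variables a b : R.
Hypotheses (a0 : 0 < a) (b0 : 0 < b).

Let an0 : a != 0. Proof. exact: lt0r_neq0. Qed.
Let bn0 : - b != 0. Proof. by rewrite oppr_eq0 lt0r_neq0. Qed.
Let abn0 : a + b != 0. Proof. by rewrite lt0r_neq0 // addr_gt0. Qed.

Lemma laplace_pdf_right x : b - a <= x ->
  (a + b)^-1 * expR (- ((x - (b - a)) / a)) <= laplace_pdf a b x.
Proof.
move=> h; rewrite ler_pM2l ?invr_gt0 ?addr_gt0 //.
by rewrite /exp_side exp_pdfE ?divr_ge0 ?subr_ge0 ?(ltW a0) // lerDl exp_pdf_ge0.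
Qed.

Lemma laplace_pdf_right_lt x : b - a < x ->
  laplace_pdf a b x = (a + b)^-1 * expR (- ((x - (b - a)) / a)).
Proof.
move=> h; congr (_ * _); rewrite /exp_side exp_pdfE; last first.
  by rewrite divr_ge0 ?(ltW a0) // subr_ge0 ltW.
by rewrite exp_pdf_lt0 ?addr0 // invrN mulrN oppr_lt0 divr_gt0 // subr_gt0.
Qed.

Lemma laplace_pdf_left_lt x : x < b - a ->
  laplace_pdf a b x = (a + b)^-1 * expR (- ((x - (b - a)) / - b)).
Proof.
move=> h; congr (_ * _); rewrite [LHS]addrC /exp_side exp_pdfE; last first.
  by rewrite -mulrNN invrN opprK divr_ge0 ?(ltW b0) // oppr_ge0 subr_le0 ltW.
by rewrite exp_pdf_lt0 ?addr0 // pmulr_llt0 ?invr_gt0 // subr_lt0.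
Qed.

Lemma laplace_momentE p : moment (laplace_pdf a b) p =
  (a + b)^-1 * (moment (exp_side a (b - a)) p + moment (exp_side (- b) (b - a)) p).
Proof.
have fa := finite_moments_exp_side (b - a) an0.
have fb := finite_moments_exp_side (b - a) bn0.
rewrite /moment -RintegralD //; try exact: integrable_poly.
rewrite -RintegralZl //; last first.
  apply: eq_integrable (integrableD _ (integrable_poly p fa) (integrable_poly p fb)) => //.
by apply: eq_Rintegral => x _; rewrite /laplace_pdf mulrCA mulrDr.
Qed.

Lemma finite_moments_laplace : finite_moments (laplace_pdf a b).
Proof.
have fa := finite_moments_exp_side (b - a) an0.
have fb := finite_moments_exp_side (b - a) bn0.
move=> k; apply: eq_integrable (integrableZl _ (a + b)^-1 (integrableD _ (fa k) (fb k))) => //.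
by move=> x _; rewrite /= -EFinD -EFinM -mulrDr mulrCA.
Qed.

Lemma laplace_moment0 : moment (laplace_pdf a b) 'X^0 = 1.
Proof.
by rewrite expr0 laplace_momentE !moment_exp_side0 // normrN !gtr0_norm // mulVf.
Qed.

Lemma laplace_moment1 : moment (laplace_pdf a b) 'X^1 = 0.
Proof.
rewrite laplace_momentE !moment_exp_side_power // expr0 !moment_exp_side0 //.
rewrite normrN !gtr0_norm // !expr1; field; exact: abn0.
Qed.

Lemma laplace_moment2 : moment (laplace_pdf a b) 'X^2 = a ^+ 2 + b ^+ 2.
Proof.
rewrite laplace_momentE !moment_exp_side_power // expr0 !moment_exp_side0 //.
rewrite normrN !gtr0_norm // !expr1; field; exact: abn0.
Qed.

(** The moment generating function M of the law satisfies
    (1 - a t) (1 + b t) M' = ((a ^ 2 + b ^ 2) t + a b (a - b) t ^ 2) M. *)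
Lemma laplace_moment_rec n :
  moment (laplace_pdf a b) 'X^(n.+3) =
    n.+2%:R * ((a - b) * moment (laplace_pdf a b) 'X^(n.+2) +
      (a ^+ 2 + b ^+ 2 + a * b * n.+1%:R) * moment (laplace_pdf a b) 'X^(n.+1) +
      a * b * (a - b) * n.+1%:R * moment (laplace_pdf a b) 'X^n).
Proof.
rewrite !laplace_momentE !moment_exp_side_power //.
rewrite normrN !gtr0_norm // -!natr1 !exprS; field; exact: abn0.
Qed.

End laplace.

Lemma derangement_consecutive_gt0 n : 0 < derangement R n.+1 + derangement R n.
Proof. by have := derangement_gt0 R n; rewrite derangementSS pmulr_rgt0. Qed.

(** By induction on the recursions: with t = a - b and a b = (1 - t ^ 2) / 2, the
    gap between the two right-hand sides has the factor (1 - t) ^ 2. *)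
Lemma laplace_moment_lt a b n : 0 < b -> b <= a -> a ^+ 2 + b ^+ 2 = 1 ->
  moment (laplace_pdf a b) 'X^(n.+3) < derangement R n.+3.
Proof.
move=> b0 ba e; have a0 : 0 < a by exact: lt_le_trans ba.
set M := fun n => moment (laplace_pdf a b) 'X^n.
set D := derangement R.
pose t := a - b; pose q := a * b.
have t0 : 0 <= t by rewrite subr_ge0.
have q0 : 0 <= q by rewrite mulr_ge0 ?(ltW a0) ?(ltW b0).
have qt : 2 * q = 1 - t ^+ 2 by move: e; rewrite /q /t; lra.
have t1 : t < 1.
  have : 0 < q by rewrite mulr_gt0.
  nra.
have step k : M k <= D k -> M k.+1 <= D k.+1 -> M k.+2 <= D k.+2 -> M k.+3 < D k.+3.
  move=> h0 h1 h2; rewrite /M laplace_moment_rec // e -/(M _) -/(M k.+1) -/(M k).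
  rewrite -/t -/q /D derangementSS -/D ltr_pM2l //.
  have k1 : (0 : R) < k.+1%:R by [].
  have D2 : D k.+2 = k.+1%:R * (D k.+1 + D k) by exact: derangementSS.
  have Dp : 0 < D k.+1 + D k by exact: derangement_consecutive_gt0.
  have D0 : 0 <= D k by exact: derangement_ge0.
  have le1 : t * M k.+2 <= t * D k.+2 by exact: ler_wpM2l.
  have le2 : (1 + q * k.+1%:R) * M k.+1 <= (1 + q * k.+1%:R) * D k.+1.
    by apply: ler_wpM2l => //; rewrite addr_ge0 // mulr_ge0.
  have le3 : q * t * k.+1%:R * M k <= q * t * k.+1%:R * D k.
    by apply: ler_wpM2l => //; rewrite mulr_ge0 // mulr_ge0.
  apply: (le_lt_trans (lerD (lerD le1 le2) le3)); rewrite -subr_gt0.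
  (* what is left is k + 1 times (1 - t) ^ 2 / 2 times a positive number *)
  have -> : D k.+2 + D k.+1 - (t * D k.+2 + (1 + q * k.+1%:R) * D k.+1 +
      q * t * k.+1%:R * D k) =
      k.+1%:R * ((1 - t) ^+ 2 / 2) * (D k.+1 + D k + (1 + t) * D k).
    have -> : q = (1 - t ^+ 2) / 2 by rewrite -qt mulrC mulKf.
    by rewrite D2; field.
  apply: mulr_gt0; last by rewrite ltr_wpDr // mulr_ge0 // addr_ge0.
  by rewrite mulr_gt0 // divr_gt0 // exprn_gt0 // subr_gt0.
suff : [/\ M n <= D n, M n.+1 <= D n.+1 & M n.+2 <= D n.+2] by case; apply: step.
elim: n => [|n [h0 h1 h2]]; last by split => //; exact/ltW/step.
rewrite /M /D derangementSS derangement1 derangement0 laplace_moment0 //.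
by rewrite laplace_moment1 // laplace_moment2 // e add0r mul1r.
Qed.

(** Writing a - b = t, the constraint a ^ 2 + b ^ 2 = 1 makes the third moment
    t (3 - t ^ 2), which covers [0, 2[ as t runs through [0, 1[. *)
Lemma laplace_third_moment s : 0 <= s < 2 -> exists a b,
  [/\ 0 < b, b <= a, a ^+ 2 + b ^+ 2 = 1 & moment (laplace_pdf a b) 'X^3 = s].
Proof.
move=> /andP[s0 s2].
pose P : {poly R} := 3%:R *: 'X - 'X^3 - s%:P.
have [||t /itvP t01 /eqP Pt] := @polyrcf.poly_ivt R P 0 1.
- exact: ler01.
- rewrite /P !hornerE; nra.
have {Pt} Pt : t * (3 - t ^+ 2) = s by move: Pt; rewrite /P !hornerE; lra.
have t1 : t < 1.
  by rewrite lt_neqAle t01 andbT; apply/eqP => t1; move: Pt; rewrite t1; lra.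
pose r := Num.sqrt (2 - t ^+ 2).
have t0 : 0 <= t by rewrite t01.
have r2 : r ^+ 2 = 2 - t ^+ 2 by rewrite sqr_sqrtr //; nra.
have r0 : 0 <= r by exact: sqrtr_ge0.
have rt : t < r by nra.
have b0 : 0 < (r - t) / 2 by lra.
have ba : (r - t) / 2 <= (r + t) / 2 by lra.
have e : ((r + t) / 2) ^+ 2 + ((r - t) / 2) ^+ 2 = 1 by lra.
exists ((r + t) / 2), ((r - t) / 2); split => //.
rewrite laplace_moment_rec ?laplace_moment2 ?laplace_moment1 ?laplace_moment0 //; try lra.
rewrite e -Pt; nra.
Qed.

End comparison_densities.

(** * Log-concave densities *)

Section log_concave_densities.
Variable R : realType.
Implicit Types (f E : R -> R) (t x y z : R).
Local Notation mu := (@lebesgue_measure R).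

Lemma log_concave_conv f t x y : log_concave_fun f -> 0 <= t -> t <= 1 ->
  0 < f x -> 0 < f y -> 0 < f (t * x + (1 - t) * y) /\
  t * ln (f x) + (1 - t) * ln (f y) <= ln (f (t * x + (1 - t) * y)).
Proof.
move=> [cs cf] t0 t1 fx fy.
have xs : x \in [set x | 0 < f x] by rewrite inE.
have ys : y \in [set x | 0 < f x] by rewrite inE.
split; first by have := cs x y (Itv01 t0 t1) xs ys; rewrite inE.
have : - ln (f (t * x + (1 - t) * y)) <= t * - ln (f x) + (1 - t) * - ln (f y).
  exact: cf (Itv01 t0 t1) x y xs ys.
lra.
Qed.

Definition log_affine E := (forall x, 0 < E x) /\
  forall t x y, ln (E (t * x + (1 - t) * y)) = t * ln (E x) + (1 - t) * ln (E y).

Lemma log_affine_exp (c d r : R) : 0 < c ->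
  log_affine (fun x => c * expR (- ((x - d) / r))).
Proof.
move=> c0; split=> [x|t x y]; first by rewrite mulr_gt0 // expR_gt0.
rewrite !lnM ?posrE ?expR_gt0 // !expRK.
rewrite (_ : t * x + (1 - t) * y - d = t * (x - d) + (1 - t) * (y - d)); last by ring.
by rewrite mulrDl -!mulrA; ring.
Qed.

(** ln f - ln E is concave where f is positive. *)
Lemma log_concave_above f E t x y : log_concave_fun f -> log_affine E ->
  0 <= t < 1 -> E x <= f x -> E y < f y ->
  E (t * x + (1 - t) * y) < f (t * x + (1 - t) * y).
Proof.
move=> lf [E0 El] /andP[t0 t1] Ex Ey.
have fx : 0 < f x by exact: lt_le_trans Ex.
have fy : 0 < f y by exact: lt_trans Ey.
have [fz lz] := log_concave_conv lf t0 (ltW t1) fx fy.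
rewrite -ltr_ln ?posrE // El (lt_le_trans _ lz) //.
rewrite ler_ltD ?ler_wpM2l // ?ler_ln ?posrE // ltr_pM2l ?subr_gt0 //.
by rewrite ltr_ln ?posrE.
Qed.

Lemma is_interval_above f E : log_concave_fun f -> log_affine E ->
  is_interval [set x | E x < f x].
Proof.
move=> lf lE x y /= Ex Ey z /andP[xz zy].
have [zx|zx] := eqVneq z x; first by rewrite /= zx.
have xy : x < y by rewrite (lt_le_trans _ zy) // lt_neqAle eq_sym zx.
have -> : z = (y - z) / (y - x) * x + (1 - (y - z) / (y - x)) * y.
  by field; rewrite subr_eq0 gt_eqF.
apply: log_concave_above => //; last exact: ltW.
rewrite divr_ge0 ?subr_ge0 ?(ltW xy) //= ltr_pdivrMr ?subr_gt0 // mul1r.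
by rewrite ltrD2l ltrN2 lt_neqAle eq_sym zx.
Qed.

(** Beyond y, ln f lies below its chord from x1 through y. Both tails are covered,
    since r has the sign of y - x1. *)
Lemma log_concave_tail f x1 y : log_concave_fun f -> (forall x, 0 <= f x) ->
  0 < f x1 -> f y < f x1 -> exists2 r, r != 0 &
  forall x, 1 < (x - x1) / (y - x1) -> f x <= f x1 * exp_side r x1 x.
Proof.
move=> lf f0 fx1 fy.
have yx1 : y - x1 != 0.
  by rewrite subr_eq0; apply: contraTneq fy => ->; rewrite ltxx.
(* f y may be 0, and then has no logarithm *)
pose v := Num.max (f y) (f x1 / 2).
have v0 : 0 < v by rewrite /v lt_max [0 < _ / _]divr_gt0 // orbT.
have v1 : v < f x1 by rewrite /v gt_max fy /=; lra.
have l0 : 0 < ln (f x1) - ln v by rewrite subr_gt0 ltr_ln // posrE.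
pose r := (y - x1) / (ln (f x1) - ln v).
have rn0 : r != 0 by rewrite mulf_neq0 // invr_eq0 lt0r_neq0.
exists r => // x hx.
have side : 0 <= (x - x1) / r.
  rewrite /r invf_div mulrCA mulr_ge0 ?(ltW l0) //.
  by rewrite (le_trans _ (ltW hx)).
rewrite /exp_side exp_pdfE // leNgt; apply/negP => lt.
pose E z := f x1 * expR (- ((z - x1) / r)).
have lE : log_affine E by exact: log_affine_exp.
pose t := 1 - ((x - x1) / (y - x1))^-1.
have u0 : 0 < ((x - x1) / (y - x1))^-1 by rewrite invr_gt0 (lt_trans _ hx).
have u1 : ((x - x1) / (y - x1))^-1 < 1 by rewrite invf_lt1 // (lt_trans _ hx).
have yE : y = t * x1 + (1 - t) * x.
  have xx1 : x - x1 != 0.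
    by apply: contraTneq hx => ->; rewrite mul0r ltNge ler01.
  by rewrite /t invf_div; field.
have : E y < f y.
  rewrite yE; apply: log_concave_above => //.
    by rewrite /t subr_ge0 (ltW u1) ltrBlDr ltrDl.
  by rewrite /E subrr mul0r oppr0 expR0 mulr1.
have -> : E y = v.
  rewrite /E /r invf_div mulrCA divff // mulr1 opprB expRD expRN !lnK ?posrE //.
  by rewrite mulrCA divff ?mulr1 // lt0r_neq0.
by rewrite /v gt_max ltxx.
Qed.


Section finite_moments.
Variable f : R -> R.
Hypotheses (mf : measurable_fun [set: R] f) (f0 : forall x, 0 <= f x).
Hypothesis f1 : (\int[mu]_x (f x)%:E = 1)%E.

Lemma integrable_density : mu.-integrable [set: R] (EFin \o f).
Proof.
apply/integrableP; split; first exact/measurable_EFinP.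
by under eq_integral do rewrite /= ger0_norm //; rewrite f1 ltry.
Qed.

Lemma moment_mass : moment f 'X^0 = 1.
Proof.
rewrite /moment /Rintegral; under eq_integral do rewrite expr0 hornerC mul1r.
by rewrite f1.
Qed.

Lemma density_lower_bound l N v : 0 <= N -> 0 <= v ->
  (forall x, l <= x <= l + N -> v <= f x) -> v * N <= 1.
Proof.
move=> N0 v0 vf; rewrite -lee_fin -f1.
have mE : measurable_fun [set: R] (EFin \o f) by exact/measurable_EFinP.
have muI : mu `[l, l + N]%classic = N%:E.
  rewrite lebesgue_measure_itv /= lte_fin ltrDl.
  case: ltP => [_|N0']; first by rewrite -EFinB addrAC subrr add0r.
  by have -> : N = 0 by apply/eqP; rewrite eq_le N0'.
have <- : (\int[mu]_(x in `[l, (l + N)%R]) (cst v%:E x) = (v * N)%:E)%E.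
  by rewrite integral_cst // [X in (_ * X)%E]muI.
apply: (@le_trans _ _ (\int[mu]_(x in `[l, (l + N)%R]) (f x)%:E)%E).
  by apply: ge0_le_integral => //; exact: measurable_funTS mE.
by apply: ge0_subset_integral => //; move=> x _; rewrite lee_fin.
Qed.

Lemma density_pos : exists x, 0 < f x.
Proof.
apply: contrapT => /forallNP h.
have : (1 <= 0 :> \bar R)%E; last by rewrite lee_fin ler10.
rewrite -f1 integral0_eq // => x _; congr (_%:E).
by apply/eqP; rewrite eq_le f0 andbT leNgt; apply/negP/h.
Qed.

Lemma density_decreases_right x1 : 0 < f x1 -> exists2 y, x1 < y & f y < f x1.
Proof.
move=> fx1; apply: contrapT => h.
have N0 : 0 <= 2 / f x1 by rewrite divr_ge0 // ltW.
have : f x1 * (2 / f x1) <= 1.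
  apply: (@density_lower_bound x1) => // x /andP[x1x _].
  rewrite leNgt; apply/negP => lt; apply: h; exists x => //.
  by rewrite lt_neqAle x1x andbT; apply: contraTneq lt => ->; rewrite ltxx.
by rewrite mulrCA divff ?mulr1 ?lt0r_neq0 //; lra.
Qed.

Lemma density_decreases_left x1 : 0 < f x1 -> exists2 y, y < x1 & f y < f x1.
Proof.
move=> fx1; apply: contrapT => h.
have N0 : 0 <= 2 / f x1 by rewrite divr_ge0 // ltW.
have : f x1 * (2 / f x1) <= 1.
  apply: (@density_lower_bound (x1 - 2 / f x1)) => // x.
  rewrite subrK => /andP[_ xx1].
  rewrite leNgt; apply/negP => lt; apply: h; exists x => //.
  by rewrite lt_neqAle xx1 andbT; apply: contraTneq lt => ->; rewrite ltxx.
by rewrite mulrCA divff ?mulr1 ?lt0r_neq0 //; lra.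
Qed.

Lemma log_concave_finite_moments : log_concave_fun f -> finite_moments f.
Proof.
move=> lf k; have [x1 fx1] := density_pos.
have [y x1y fy] := density_decreases_right fx1.
have [z zx1 fz] := density_decreases_left fx1.
have [r r0 fr] := log_concave_tail lf f0 fx1 fy.
have [q q0 fq] := log_concave_tail lf f0 fx1 fz.
pose B := Num.max `|y| `|z|.
have i1 := integrable_norm (finite_moments_exp_side x1 r0 k).
have i2 := integrable_norm (finite_moments_exp_side x1 q0 k).
have i12 := integrableZl measurableT (f x1) (integrableD measurableT i1 i2).
have i3 := integrableD measurableT (integrableZl measurableT (B ^+ k) integrable_density) i12.
apply: le_integrable i3 => //.
  by apply/measurable_EFinP; apply: measurable_funM => //; exact: measurable_funX.
move=> x _ /=; rewrite lee_fin.
have B0 : 0 <= B by rewrite /B le_max normr_ge0.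
have e0 c : 0 <= f x1 * `|x ^+ k * exp_side c x1 x| by rewrite mulr_ge0 // ltW.
rewrite mulrDr [leRHS]ger0_norm; last by rewrite !addr_ge0 // mulr_ge0 // exprn_ge0.
rewrite normrM (ger0_norm (f0 x)).
have tail c : f x <= f x1 * exp_side c x1 x ->
    `|x ^+ k| * f x <= f x1 * `|x ^+ k * exp_side c x1 x|.
  by move=> h; rewrite normrM (ger0_norm (exp_side_ge0 _ _ _)) mulrCA ler_wpM2l.
have b0 : 0 <= B ^+ k * f x by rewrite mulr_ge0 // exprn_ge0.
have [yx|xy] := ltP y x.
  have /tail h : f x <= f x1 * exp_side r x1 x.
    by apply: fr; rewrite ltr_pdivlMr ?subr_gt0 // mul1r ltrD2r.
  by rewrite (le_trans h) // ler_wpDl // lerDl.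
have [xz|zx] := ltP x z.
  have /tail h : f x <= f x1 * exp_side q x1 x.
    by apply: fq; rewrite ltr_ndivlMr ?subr_lt0 // mul1r ltrD2r.
  by rewrite (le_trans h) // ler_wpDl // lerDr.
rewrite ler_wpDr ?addr_ge0 // ler_wpM2r // normrX lerXn2r ?nnegrE //.
rewrite /B le_max; have [x0|x0] := leP 0 x.
  by rewrite (ger0_norm x0) (le_trans xy (ler_norm y)).
by rewrite (ltr0_norm x0) -(normrN z) (le_trans _ (ler_norm (- z))) ?orbT // lerN2.
Qed.

End finite_moments.

End log_concave_densities.

(** * Comparison of moments *)

Section moment_comparison.
Variable R : realType.
Implicit Types (f g h : R -> R) (p q : {poly R}) (a b c d x : R).
Local Notation mu := (@lebesgue_measure R).

Lemma moment_ae_eq0 h p : finite_moments h -> {ae mu, forall x, h x = 0} ->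
  moment h p = 0.
Proof.
move=> hm h0; rewrite /moment /Rintegral.
rewrite (ae_eq_integral (cst 0%E)) ?integral0 //.
  exact: measurable_int (integrable_poly p hm).
by apply: negligibleS h0 => x /=; apply: contra_not => hx _; rewrite hx mulr0.
Qed.

Section sign_changes.
Variables (h : R -> R) (m : nat).
Hypotheses (hm : finite_moments h) (h0 : forall k, (k < m)%N -> moment h 'X^k = 0).

Lemma ae_eq0_few_sign_changes p : p != 0 -> (size p <= m)%N ->
  (forall x, p.[x] * h x <= 0) -> {ae mu, forall x, h x = 0}.
Proof.
move=> p0 sp ph; apply: (ae_eq0_of_moment_eq0 hm p0 ph).
exact: moment_eq0_small sp.
Qed.

(** Subtracting from p its interpolation polynomial at the sign changes of h
    leaves the integral unchanged and gives the integrand a constant sign. *)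
Lemma moment_le0_sign_changes (s : seq R) p : size s = m ->
  (forall x, (\prod_(c <- s) ('X - c%:P)).[x] * h x <= 0) ->
  (forall x, 0 <= p^`(m).[x]) ->
  moment h p <= 0 /\
  ((m < size p)%N -> moment h p = 0 -> {ae mu, forall x, h x = 0}).
Proof.
move=> sm sh; rewrite -sm => p0.
have [q [r [pE q0 sr]]] := divided_difference_ge0 p0; rewrite sm in sr.
set Q := \prod_(c <- s) _ in sh pE.
have mE : moment h p = moment h (q * Q).
  by rewrite pE momentD // (moment_eq0_small hm h0 (p := r)) ?addr0 //.
rewrite mE; split; first exact: moment_mul_le0.
move=> sp; apply: ae_eq0_of_moment_eq0 => //.
  apply: contraTneq sp => qQ0; rewrite pE qQ0 add0r -leqNgt sm //.
by move=> x; rewrite hornerM -mulrA mulr_ge0_le0.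
Qed.

End sign_changes.

Section normalized.
Variable f : R -> R.
Hypotheses (mf : measurable_fun [set: R] f) (f0 : forall x, 0 <= f x).
Hypotheses (f1 : (\int[mu]_x (f x)%:E = 1)%E) (lf : log_concave_fun f).
Hypotheses (mean0 : moment f 'X = 0) (var1 : moment f 'X^2 = 1).

Let fm : finite_moments f. Proof. exact: log_concave_finite_moments. Qed.

Let mass1 : moment f 'X^0 = 1. Proof. exact: moment_mass. Qed.

(** Against the density of Gamma, f is at least as large to the left of -1, and
    larger exactly on an interval to the right of -1: the difference changes sign at most three
    times, while its moments of order 0, 1 and 2 vanish. *)
Lemma third_moment_le2 : moment f 'X^3 <= 2 /\
  (moment f 'X^3 = 2 -> {ae mu, forall x, f x = gamma_pdf x}).
Proof.
pose h x := f x - gamma_pdf x.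
have gm := @finite_moments_gamma R.
have hm : finite_moments h by exact: finite_momentsB.
have h0 k : (k < 3)%N -> moment h 'X^k = 0.
  move=> k3; rewrite momentB // moment_gamma.
  case: k k3 => [|[|[|//]]] _.
  - by rewrite mass1 derangement0 subrr.
  - by rewrite mean0 derangement1 subrr.
  - by rewrite var1 derangementSS derangement1 derangement0 add0r mul1r subrr.
have h3 : moment h 'X^3 = moment f 'X^3 - 2.
  rewrite momentB // moment_gamma !derangementSS derangement1 derangement0.
  by congr (_ - _); ring.
have aeh : {ae mu, forall x, h x = 0} -> {ae mu, forall x, f x = gamma_pdf x}.
  by apply: negligibleS => x /=; apply: contra_not => /eqP; rewrite subr_eq0 => /eqP.
pose E x : R := 1 * expR (- ((x - -1) / 1)).
have lE : log_affine E by apply: log_affine_exp.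
pose I := [set x | -1 <= x /\ E x < f x].
have itvI : is_interval I.
  move=> x y [x1 Ex] [y1 Ey] z /andP[xz zy]; split; first exact: le_trans xz.
  by apply: (is_interval_above lf lE Ex Ey); rewrite xz zy.
have [q [q0 qs qI qnI qx0]] := interval_sign_poly_right itvI (fun x (Ix : I x) => proj1 Ix).
have sgn x : (('X - (-1)%:P) * q).[x] * h x <= 0.
  rewrite hornerM hornerXsubC /h gamma_pdfE /exp_side.
  have [x1|x1] := ltP x (-1).
    rewrite divr1 exp_pdf_lt0 ?subr_lt0 // subr0 mulr_le0_ge0 // mulr_le0_ge0 //.
      by rewrite subr_le0 ltW.
    by rewrite qx0 // ltW.
  rewrite exp_pdfE ?divr1 ?subr_ge0 // -mulrA mulr_ge0_le0 ?subr_ge0 //.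
  have EE : E x = expR (- (x - -1)) by rewrite /E mul1r divr1.
  have [fE|fE] := ltP (E x) (f x).
    by rewrite mulr_le0_ge0 ?qI // subr_ge0 -EE ltW.
  by rewrite mulr_ge0_le0 ?subr_le0 -?EE // qnI // => -[_]; rewrite ltNge fE.
case: qs => [qs|[c [d qE]]].
  have ae0 : {ae mu, forall x, h x = 0}.
    apply: (ae_eq0_few_sign_changes hm h0 _ _ sgn); first by rewrite mulf_neq0 // polyXsubC_eq0.
    by rewrite size_mul ?polyXsubC_eq0 // size_XsubC.
  have /eqP := moment_ae_eq0 'X^3 hm ae0; rewrite h3 subr_eq0 => /eqP ->.
  by split=> // _; exact: aeh.
have [] := @moment_le0_sign_changes h 3 hm h0 [:: -1; c; d] 'X^3.
- by [].
- by move=> x; rewrite !big_cons big_nil mulr1 -qE.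
- by move=> x; rewrite derivnXn hornerMn hornerXn subnn expr0 mulrn_wge0.
rewrite h3 subr_le0 => le2 eq2; split=> // e.
by apply/aeh/eq2; rewrite ?size_polyXn // e subrr.
Qed.

(** On each side of the peak of the Laplace density f is larger exactly on an
    interval: the difference changes sign at most four times, while its moments
    of order 0 to 3 vanish. With fewer sign changes it is 0 almost everywhere. *)
Lemma moment_le_laplace a b n : 0 < a -> 0 < b -> a ^+ 2 + b ^+ 2 = 1 ->
  moment (laplace_pdf a b) 'X^3 = moment f 'X^3 -> ~~ odd n ->
  moment f 'X^n <= moment (laplace_pdf a b) 'X^n.
Proof.
move=> a0 b0 e e3 on; rewrite -subr_le0.
have gm := finite_moments_laplace a0 b0.
rewrite -momentB //; set h := fun x => _.
have hm : finite_moments h by exact: finite_momentsB.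
have h0 k : (k < 4)%N -> moment h 'X^k = 0.
  move=> k4; rewrite momentB //.
  case: k k4 => [|[|[|[|//]]]] _.
  - by rewrite mass1 laplace_moment0 // subrr.
  - by rewrite mean0 laplace_moment1 // subrr.
  - by rewrite var1 laplace_moment2 // e subrr.
  - by rewrite e3 subrr.
pose x0 := b - a.
have c0 : 0 < (a + b)^-1 by rewrite invr_gt0 addr_gt0.
pose E r x := (a + b)^-1 * expR (- ((x - x0) / r)).
have lE r : log_affine (E r) by apply: log_affine_exp.
pose I := [set x | x0 <= x /\ E a x < f x].
pose J := [set x | x <= x0 /\ E (- b) x < f x].
have itvI : is_interval I.
  move=> x y [x1 Ex] [y1 Ey] z /andP[xz zy]; split; first exact: le_trans xz.
  by apply: (is_interval_above lf (lE a) Ex Ey); rewrite xz zy.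
have itvJ : is_interval J.
  move=> x y [x1 Ex] [y1 Ey] z /andP[xz zy]; split; first exact: le_trans y1.
  by apply: (is_interval_above lf (lE (- b)) Ex Ey); rewrite xz zy.
have [q [q0 qs qI qnI qx]] := interval_sign_poly_right itvI (fun x (Ix : I x) => proj1 Ix).
have [p [p0 ps pJ pnJ px]] := interval_sign_poly_left itvJ (fun x (Jx : J x) => proj1 Jx).
have sgn x : (p * q).[x] * h x <= 0.
  rewrite hornerM /h; case: (ltgtP x x0) => [xx0|xx0|xx0].
  - rewrite laplace_pdf_left_lt // -/(E (- b) x) mulrAC.
    apply: mulr_le0_ge0; last by apply: qx; exact: ltW.
    have [fE|fE] := ltP (E (- b) x) (f x).
      apply: mulr_le0_ge0; last by rewrite subr_ge0 ltW.
      by apply: pJ; split=> //; exact: ltW.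
    by rewrite mulr_ge0_le0 ?subr_le0 // pnJ // => -[_]; rewrite ltNge fE.
  - rewrite laplace_pdf_right_lt // -/(E a x) -mulrA.
    apply: mulr_ge0_le0; first by apply: px; exact: ltW.
    have [fE|fE] := ltP (E a x) (f x).
      apply: mulr_le0_ge0; last by rewrite subr_ge0 ltW.
      by apply: qI; split=> //; exact: ltW.
    by rewrite mulr_ge0_le0 ?subr_le0 // qnI // => -[_]; rewrite ltNge fE.
  - (* at the peak both polynomials are nonnegative *)
    have [fE|fE] := ltP (E a x) (f x).
      have -> : q.[x] = 0; last by rewrite mulr0 mul0r.
      by apply: le_anti; rewrite qI /= ?qx ?xx0 // /I /= -xx0; split.
    rewrite mulr_ge0_le0 ?mulr_ge0 ?px ?qx ?xx0 //.
    by rewrite -xx0 subr_le0 (le_trans fE) // laplace_pdf_right // xx0.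
have small : (size (p * q)%R <= 4)%N -> moment h 'X^n <= 0.
  move=> spq; rewrite (moment_ae_eq0 'X^n hm) //.
  by apply: (ae_eq0_few_sign_changes hm h0 _ spq sgn); rewrite mulf_neq0.
have size_split (c d : R) : size (('X - c%:P) * ('X - d%:P)) = 3.
  by rewrite size_mul ?polyXsubC_eq0 // !size_XsubC.
have le3 (u : {poly R}) : linear_or_split u -> (size u <= 3)%N.
  by case=> [/leq_trans->//|[c [d ->]]]; rewrite size_split.
case: ps (le3 _ ps) => [ps _|[c [d pE]] ps3].
  apply: small; rewrite (leq_trans (size_polyMleq _ _)) //.
  by have := leq_add ps (le3 _ qs); case: (_ + _)%N.
case: qs => [qs|[c' [d' qE]]].
  apply: small; rewrite (leq_trans (size_polyMleq _ _)) //.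
  by have := leq_add ps3 qs; case: (_ + _)%N.
have [] := @moment_le0_sign_changes h 4 hm h0 [:: c; d; c'; d'] 'X^n.
- by [].
- by move=> x; rewrite !big_cons big_nil mulr1 mulrA -pE -qE.
- by move=> x; exact: even_power_derivn_ge0.
by [].
Qed.

(** The law with the same moments of order 0 to 3 is Gamma if the third moment is 2,
    and a proper Laplace law, with strictly smaller even moments, otherwise. *)
Theorem moment_le_derangement n : 0 <= moment f 'X^3 -> (2 < n)%N -> ~~ odd n ->
  moment f 'X^n <= derangement R n /\
  (moment f 'X^n = derangement R n -> {ae mu, forall x, f x = gamma_pdf x}).
Proof.
move=> s0 n2 on; have [s2 ae2] := third_moment_le2.
have [s2'|s2'] := ltP (moment f 'X^3) 2; last first.
  have ae0 : {ae mu, forall x, f x = gamma_pdf x}.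
    by apply: ae2; apply: le_anti; rewrite s2 s2'.
  split=> //; rewrite -moment_gamma -subr_le0 -momentB //; last exact: finite_moments_gamma.
  rewrite moment_ae_eq0 //; first by apply: finite_momentsB => //; exact: finite_moments_gamma.
  by apply: negligibleS ae0 => x /=; apply: contra_not => ->; rewrite subrr.
have [a [b [b0 ba e e3]]] : exists a b, [/\ 0 < b, b <= a, a ^+ 2 + b ^+ 2 = 1 &
    moment (laplace_pdf a b) 'X^3 = moment f 'X^3].
  by apply: laplace_third_moment; rewrite s0.
have a0 : 0 < a by exact: lt_le_trans ba.
have lt : moment f 'X^n < derangement R n.
  apply: le_lt_trans (moment_le_laplace a0 b0 e e3 on) _.
  by case: n n2 {on} => [|[|[|n]]] // _; exact: laplace_moment_lt.
by split=> [|eq]; [exact: ltW|move: lt; rewrite eq ltxx].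
Qed.

End normalized.

End moment_comparison.

(** * Random variables with a density *)

Section integral_against_density.
Variable R : realType.
Implicit Types (f phi : R -> R).
Local Notation mu := (@lebesgue_measure R).

(** A density is almost everywhere a Radon-Nikodym derivative. *)
Lemma ge0_integral_probability_density
    (nu : probability (measurableTypeR R) R) f phi :
  measurable_fun [set: R] f -> (forall x, 0 <= f x) ->
  (forall A, measurable A -> nu A = (\int[mu]_(x in A) (f x)%:E)%E) ->
  measurable_fun [set: R] phi -> (forall x, 0 <= phi x) ->
  (\int[nu]_x (phi x)%:E = \int[mu]_x (phi x * f x)%:E)%E.
Proof.
move=> mf f0 fX mphi phi0.
have mphiE : measurable_fun [set: R] (EFin \o phi) by exact/measurable_EFinP.
have mfE : measurable_fun [set: R] (EFin \o f) by exact/measurable_EFinP.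
have fi : mu.-integrable [set: R] (EFin \o f).
  by apply: integrable_density => //; rewrite -fX ?probability_setT.
pose la : {sigma_finite_measure set (measurableTypeR R) -> \bar R} := mu.
have numu : nu `<< la.
  move=> A A0 B mB BA; rewrite [LHS]fX // null_set_integral //.
    exact: measurable_funTS mfE.
  exact: A0 BA.
pose g := Radon_Nikodym_SigmaFinite.f nu la.
have mg : measurable_fun [set: R] g.
  exact: measurable_int (Radon_Nikodym_SigmaFinite.f_integrable numu).
have gf : ae_eq mu [set: R] (EFin \o f) g.
  apply: integral_ae_eq => // E _ mE.
  by rewrite -[LHS]fX // -Radon_Nikodym_SigmaFinite.f_integral.
rewrite -(Radon_Nikodym_SigmaFinite.change_of_variables numu) //.
apply: ae_eq_integral => //.
- exact: emeasurable_funM.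
- by apply/measurable_EFinP; exact: measurable_funM.
- apply: negligibleS gf => x /=; apply: contra_not => fg _.
  by rewrite EFinM -/(g x) -fg.
Qed.

End integral_against_density.

Section random_variables.
Variable R : realType.
Context (d : measure_display) (T : measurableType d) (P : probability T R).
Implicit Types (X : {RV P >-> R}) (f : R -> R) (c : R).
Local Notation mu := (@lebesgue_measure R).

Lemma has_density_mass X f : has_density X f -> (\int[mu]_x (f x)%:E = 1)%E.
Proof.
case=> mf f0 Xf; rewrite -Xf; last exact: measurableT.
exact: probability_setT.
Qed.

Lemma ge0_integral_density X f (phi : R -> R) : has_density X f ->
  measurable_fun [set: R] phi -> (forall x, 0 <= phi x) ->
  (\int[P]_t (phi (X t))%:E = \int[mu]_x (phi x * f x)%:E)%E.
Proof.
move=> [mf f0 fX] mphi phi0.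
(* the Lebesgue measure lives on measurableTypeR R, which has the same measurable
   sets as R but another display *)
have mX : measurable_fun [set: T] (X : T -> measurableTypeR R).
  by move=> mT Y mY; exact: (measurable_funPT X mT Y mY).
pose X' : {mfun T >-> measurableTypeR R} :=
  MeasurableFun.Pack (MeasurableFun.Class (isMeasurableFun.Build _ _ _ _ _ mX)).
rewrite -(@ge0_integral_probability_density R (distribution P X')) //.
by rewrite ge0_integral_distribution //; exact/measurable_EFinP.
Qed.

End random_variables.

(** * Rescaling a density *)

Section rescaling.
Variable R : realType.
Implicit Types (f : R -> R) (c : R).
Local Notation mu := (@lebesgue_measure R).

(** The density of X / c when f is that of X. *)
Definition rescale c f : R -> R := fun x => `|c| * f (c * x).

Lemma measurable_rescale c f : measurable_fun [set: R] f ->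
  measurable_fun [set: R] (rescale c f).
Proof.
by move=> mf; apply: measurable_funM => //; apply: measurableT_comp.
Qed.

Lemma integral_rescale c f (A : set R) : c != 0 -> measurable A ->
  measurable_fun [set: R] f -> (forall x, 0 <= f x) ->
  (\int[mu]_(x in A) (f x)%:E =
   \int[mu]_(x in [set y | A (c * y)%R]) (rescale c f x)%:E)%E.
Proof.
move=> c0 mA mf f0; rewrite [LHS]integral_mkcond [RHS]integral_mkcond.
have mg : measurable_fun [set: R] ((EFin \o f) \_ A).
  apply: (measurable_restrictT (EFin \o f) mA).1; apply: measurable_funTS.
  exact/measurable_EFinP.
have g0 x : (0 <= ((EFin \o f) \_ A) x)%E.
  by rewrite patchE; case: ifP => // _; rewrite lee_fin.
rewrite (ge0_integral_affine 0 c0 mg g0) -ge0_integralZl_EFin //; last first.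
  exact: (measurableT_comp mg (measurable_affine c 0)).
apply: eq_integral => y _; rewrite add0r !patchE.
have -> : (y \in [set y | A (c * y)]) = (c * y \in A) by apply/idP/idP; rewrite !inE.
by case: ifP => _ /=; rewrite ?mule0 // -EFinM.
Qed.

Lemma log_concave_of_conv f :
  (forall t x y, 0 <= t -> t <= 1 -> 0 < f x -> 0 < f y ->
    0 < f (t * x + (1 - t) * y) /\
    t * ln (f x) + (1 - t) * ln (f y) <= ln (f (t * x + (1 - t) * y))) ->
  log_concave_fun f.
Proof.
move=> h; split=> [x y t|t x y]; rewrite !inE /= => fx fy.
  by have [] := h t%:num x y (ge0 t) (le1 t) fx fy.
have [_ le] := h t%:num x y (ge0 t) (le1 t) fx fy.
suff : - ln (f (t%:num * x + (1 - t%:num) * y)) <=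
  t%:num * - ln (f x) + (1 - t%:num) * - ln (f y) by [].
lra.
Qed.

Lemma log_concave_rescale c f : c != 0 -> log_concave_fun f -> log_concave_fun (rescale c f).
Proof.
move=> c0 lf; have n0 : 0 < `|c| by rewrite normr_gt0.
apply: log_concave_of_conv => t x y t0 t1; rewrite /rescale !pmulr_rgt0 // => fx fy.
have -> : c * (t * x + (1 - t) * y) = t * (c * x) + (1 - t) * (c * y) by ring.
have [fz le] := log_concave_conv lf t0 t1 fx fy.
by split=> //; rewrite !lnM ?posrE //; lra.
Qed.

Section density.
Variable f : R -> R.
Hypotheses (mf : measurable_fun [set: R] f) (f0 : forall x, 0 <= f x).
Hypotheses (f1 : (\int[mu]_x (f x)%:E = 1)%E) (lf : log_concave_fun f).

Lemma rescale_ge0 c x : 0 <= rescale c f x.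
Proof. by rewrite mulr_ge0. Qed.

Lemma rescale_mass c : c != 0 -> (\int[mu]_x (rescale c f x)%:E = 1)%E.
Proof. by move=> c0; rewrite -f1 (@integral_rescale c f setT). Qed.

Lemma moment_rescale c k : c != 0 ->
  moment f 'X^k = c ^+ k * moment (rescale c f) 'X^k.
Proof.
move=> c0.
have fm : finite_moments (rescale c f).
  apply: log_concave_finite_moments (rescale_ge0 c) (rescale_mass c0) _.
    exact: measurable_rescale.
  exact: log_concave_rescale.
have mF : measurable_fun [set: R] (fun x : R => ('X^k).[x] * f x).
  exact: measurable_horner_mul.
have n0 : `|c| != 0 by rewrite normr_eq0.
have E y : ('X^k).[0 + c * y] * f (0 + c * y) =
    (`|c|^-1 * c ^+ k) * (('X^k).[y] * rescale c f y).
  by rewrite add0r !hornerXn /rescale exprMn; field.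
have i := integrable_poly 'X^k fm.
rewrite /moment (@Rintegral_affine _ c 0 _ c0 mF).
  under eq_Rintegral do rewrite E.
  by rewrite RintegralZl // !mulrA divff // mul1r.
apply: eq_integrable (integrableZl measurableT (`|c|^-1 * c ^+ k) i) => // y _.
by rewrite /= E EFinM.
Qed.

Lemma second_moment_gt0 : 0 < moment f 'X^2.
Proof.
have fm : finite_moments f by exact: log_concave_finite_moments.
rewrite lt_neqAle eq_sym; apply/andP; split; last first.
  by apply: Rintegral_ge0 => x _; rewrite hornerXn mulr_ge0 // sqr_ge0.
apply/eqP => m0.
have : {ae mu, forall x, f x = 0}.
  apply: (ae_eq0_of_moment_eq0 (Q := -1 *: 'X^2) fm).
  - by rewrite scaler_eq0 oppr_eq0 oner_eq0 /= monic_neq0 // monicXn.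
  - by move=> x; rewrite hornerZ hornerXn mulN1r mulNr oppr_le0 mulr_ge0 ?sqr_ge0.
  - by rewrite momentZ // m0 mulr0.
by move=> /(moment_ae_eq0 'X^0 fm); rewrite (moment_mass f1) => /eqP; rewrite oner_eq0.
Qed.

End density.

End rescaling.

(** * The moment inequality for centered log-concave densities *)

Section centered_densities.
Variable R : realType.
Local Notation mu := (@lebesgue_measure R).
Variable f : R -> R.
Hypotheses (mf : measurable_fun [set: R] f) (f0 : forall x, 0 <= f x).
Hypotheses (f1 : (\int[mu]_x (f x)%:E = 1)%E) (lf : log_concave_fun f).
Hypothesis mean0 : moment f 'X = 0.

(** Scaling by the standard deviation, with the sign that makes the third moment
    nonnegative, reduces to the normalized case. *)
Theorem centered_moment_le_derangement n : (2 < n)%N -> ~~ odd n ->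
  let s := Num.sqrt (moment f 'X^2) in
  moment f 'X^n <= s ^+ n * derangement R n /\
  (moment f 'X^n = s ^+ n * derangement R n -> exists c, [/\ c != 0, `|c| = s &
     {ae mu, forall x, rescale c f x = gamma_pdf x}]).
Proof.
move=> n2 on s.
have m2 : 0 < moment f 'X^2 by exact: second_moment_gt0.
have s0 : 0 < s by rewrite sqrtr_gt0.
have s2 : s ^+ 2 = moment f 'X^2 by rewrite sqr_sqrtr // ltW.
have [c [c0 cs c3]] : exists c, [/\ c != 0, `|c| = s & 0 <= c ^+ 3 * moment f 'X^3].
  have [m3|m3] := leP 0 (moment f 'X^3).
    exists s; split; rewrite ?lt0r_neq0 ?gtr0_norm //.
    by rewrite mulr_ge0 // exprn_ge0 // ltW.
  exists (- s); split; rewrite ?oppr_eq0 ?lt0r_neq0 ?normrN ?gtr0_norm //.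
  by rewrite exprNn -signr_odd mulN1r mulr_le0 ?(ltW m3) // oppr_le0 exprn_ge0 // ltW.
have mE k : moment f 'X^k = c ^+ k * moment (rescale c f) 'X^k by exact: moment_rescale.
have cn : c ^+ n = s ^+ n by rewrite -cs -normrX ger0_norm // exprn_even_ge0.
have cp : 0 < s ^+ n by rewrite exprn_gt0.
have := @moment_le_derangement R (rescale c f) (measurable_rescale c mf)
  (rescale_ge0 f0 c) (rescale_mass mf f0 f1 c0) (log_concave_rescale c0 lf) _ _ n _ n2 on.
case.
- have := mE 1; rewrite expr1 mean0 => /esym/eqP.
  by rewrite mulf_eq0 expf_eq0 (negbTE c0) andbF => /eqP.
- have := mE 2; rewrite -s2 -cs -normrX ger0_norm ?sqr_ge0 // => e.
  by apply: (mulfI (expf_neq0 2 c0)); rewrite -e mulr1.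
- move: c3; rewrite mE mulrA -exprD pmulr_rge0 //.
  by rewrite exprn_even_gt0.
move=> le eq; rewrite mE cn; split; first by rewrite ler_pM2l.
by move=> /(mulfI (lt0r_neq0 cp))/eq h; exists c.
Qed.

End centered_densities.

(** * Norms, means and laws *)

Section norms.
Variable R : realType.
Context (d : measure_display) (T : measurableType d) (P : probability T R).
Implicit Types (X : {RV P >-> R}) (f : R -> R) (c a v : R) (n : nat).
Local Notation mu := (@lebesgue_measure R).

(** Neither side need be finite, so the positive and negative
    parts are treated separately. *)
Lemma expectation_density X f : has_density X f ->
  ('E_P[X] = \int[mu]_x (x * f x)%:E)%E.
Proof.
move=> Xf; have [mf f0 _] := Xf.
rewrite unlock [LHS]integralE [RHS]integralE; congr (_ - _)%E.
- transitivity (\int[P]_t (Num.max (X t) 0)%:E)%E.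
    by apply: eq_integral => t _; rewrite funeposE -EFin_max.
  rewrite (ge0_integral_density (phi := fun x => Num.max x 0) Xf) //.
  + apply: eq_integral => x _; rewrite funeposE -EFin_max maxr_pMl //.
    by rewrite mul0r.
  + exact: measurable_maxr.
  + by move=> x; rewrite le_max lexx orbT.
- transitivity (\int[P]_t (Num.max (- X t) 0)%:E)%E.
    by apply: eq_integral => t _; rewrite funenegE -EFinN -EFin_max.
  rewrite (ge0_integral_density (phi := fun x => Num.max (- x) 0) Xf) //.
  + apply: eq_integral => x _; rewrite funenegE -EFinN -EFin_max maxr_pMl //.
    by rewrite mul0r mulNr.
  + exact: measurable_maxr.
  + by move=> x; rewrite le_max lexx orbT.
Qed.

Lemma centered_moment X f : has_density X f -> centered X -> moment f 'X = 0.
Proof.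
move=> Xf; rewrite /centered (expectation_density Xf) /moment /Rintegral => e.
by under eq_integral do rewrite hornerX; rewrite e.
Qed.

Lemma even_power_integral_density X f n : has_density X f -> finite_moments f ->
  ~~ odd n -> (\int[P]_t (X t ^+ n)%:E = (moment f 'X^n)%:E)%E.
Proof.
move=> Xf fm on; rewrite (ge0_integral_density (phi := fun x => x ^+ n) Xf).
- rewrite /moment /Rintegral fineK.
    by under [RHS]eq_integral do rewrite hornerXn.
  by apply: integrable_fin_num => //; exact: integrable_poly.
- exact: measurable_funX.
- by move=> x; rewrite exprn_even_ge0.
Qed.

Lemma norm_RV_even X n a : (0 < n)%N -> ~~ odd n ->
  (\int[P]_t (X t ^+ n)%:E = a%:E)%E -> norm_RV X n%:R = (a `^ (n%:R)^-1)%:E.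
Proof.
move=> n0 on e; rewrite /norm_RV unlock -poweR_EFin -e; congr (_ `^ _)%E.
apply: eq_integral => t _ /=.
by rewrite powR_mulrn // -normrX ger0_norm // exprn_even_ge0.
Qed.

Lemma norm_ratio X n a v D : (0 < n)%N -> ~~ odd n -> 0 <= a -> 0 < v -> 0 <= D ->
  (\int[P]_t (X t ^+ n)%:E = a%:E)%E -> (\int[P]_t (X t ^+ 2)%:E = v%:E)%E ->
  ((norm_RV X n%:R / norm_RV X 2 <= (D `^ (n%:R)^-1)%:E)%E = (a <= Num.sqrt v ^+ n * D)) /\
  ((norm_RV X n%:R / norm_RV X 2 = (D `^ (n%:R)^-1)%:E)%E <-> a = Num.sqrt v ^+ n * D).
Proof.
move=> n0 on a0 v0 D0 ea ev.
have s0 : 0 < Num.sqrt v by rewrite sqrtr_gt0.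
have nr0 : (0 : R) < n%:R^-1 by rewrite invr_gt0 ltr0n.
have n2 : norm_RV X 2 = (Num.sqrt v)%:E.
  by rewrite (@norm_RV_even X 2 v) // powR12_sqrt // ltW.
have root : (Num.sqrt v ^+ n * D) `^ (n%:R)^-1 = Num.sqrt v * D `^ (n%:R)^-1.
  rewrite powRM ?exprn_ge0 ?(ltW s0) // -powR_mulrn ?(ltW s0) // -powRrM.
  by rewrite divff ?pnatr_eq0 ?lt0n_neq0 // powRr1 // ltW.
have b0 : 0 <= Num.sqrt v ^+ n * D by rewrite mulr_ge0 // exprn_ge0 // ltW.
rewrite n2 (norm_RV_even n0 on ea) inver (gt_eqF s0) -EFinM lee_fin.
split.
  rewrite ler_pdivrMr // mulrC -root.
  apply/idP/idP => [|h]; last by apply: ge0_ler_powR => //; exact: ltW.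
  apply: contraLR; rewrite -!ltNge => h; apply: gt0_ltr_powR => //.
split=> [[e]|->].
  apply: (powR_injective nr0); rewrite ?nnegrE // root -e mulrC divfK //.
  exact: lt0r_neq0.
by congr (_%:E); rewrite root mulrC mulKf // lt0r_neq0.
Qed.

End norms.

Section laws.
Variable R : realType.
Context (d d' : measure_display) (T : measurableType d) (T' : measurableType d').
Context (P : probability T R) (Q : probability T' R).
Implicit Types (X : {RV P >-> R}) (G Y : {RV Q >-> R}) (f : R -> R) (c : R).
Local Notation mu := (@lebesgue_measure R).

Lemma distribution_rescale X G f g c : has_density X f -> has_density G g -> c != 0 ->
  {ae mu, forall x, rescale c f x = g x} -> forall A : set R, measurable A ->
  distribution P X A = distribution Q G [set y | A (c * y)].
Proof.
move=> [mf f0 fX] [mg g0 gG] c0 fg A mA.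
have mB : measurable [set y | A (c * y)].
  have mc : measurable_fun [set: R] (fun y => c * y) by exact: measurable_funM.
  by have := mc measurableT A mA; rewrite setTI.
rewrite fX // gG // (integral_rescale c0) //.
apply: ae_eq_integral => //.
- by apply: measurable_funTS; apply/measurable_EFinP; exact: measurable_rescale.
- by apply: measurable_funTS; exact/measurable_EFinP.
- by apply: negligibleS fg => x /=; apply: contra_not => -> _.
Qed.

Lemma eq_law_even_power X Y n : eq_law X Y -> ~~ odd n ->
  (\int[P]_t (X t ^+ n)%:E = \int[Q]_t (Y t ^+ n)%:E)%E.
Proof.
move=> XY on; pose phi (x : R) : \bar R := (x ^+ n)%:E.
have mphi : measurable_fun [set: R] phi by apply/measurable_EFinP; exact: measurable_funX.
have phi0 x : (0 <= phi x)%E by rewrite lee_fin exprn_even_ge0.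
rewrite -[LHS](ge0_integral_distribution X mphi phi0).
rewrite -[RHS](ge0_integral_distribution Y mphi phi0).
by apply: eq_measure_integral => A mA _; exact: XY.
Qed.

End laws.

Lemma even_power_gamma (R : realType) (d : measure_display) (T : measurableType d)
    (Q : probability T R) (G : {RV Q >-> R}) (c : R) n :
  has_density G (@gamma_pdf R) -> ~~ odd n ->
  (\int[Q]_t ((G t * c) ^+ n)%:E = (c ^+ n * derangement R n)%:E)%E.
Proof.
move=> Gg on; have [mg _ _] := Gg.
have e := even_power_integral_density Gg (@finite_moments_gamma R) on.
under eq_integral do rewrite exprMn mulrC EFinM.
rewrite ge0_integralZl_EFin ?exprn_even_ge0 //.
- by rewrite e moment_gamma -EFinM.
- by move=> t _; rewrite lee_fin exprn_even_ge0.
- by apply/measurable_EFinP; exact: measurable_funX.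
Qed.

(** * The sharp bound *)

Theorem theorem4 (R : realType) (d : measure_display) (T : measurableType d)
    (P : probability T R) (X : {RV P >-> R}) (n : nat)
    (hlc : log_concave X) (hc : centered X) (hn : (2 < n)%N) (hev : ~~ odd n) :
  let K : R := (n`!%:R * \sum_(0 <= i < n.+1) (-1) ^+ i / i`!%:R)
                 `^ (n%:R)^-1 in
  [/\ (norm_RV X n%:R / norm_RV X 2 <= K%:E)%E,
      K = (subfactorial n)%:R `^ (n%:R)^-1 &
      forall (d' : measure_display) (T' : measurableType d')
             (Q : probability T' R) (G : {RV Q >-> R}),
        has_density G (@gamma_pdf R) ->
        ((norm_RV X n%:R / norm_RV X 2)%E = K%:E <->
         exists2 c : R, 0 < c &
           eq_law X (c \o* G : {RV Q >-> R}) \/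
           eq_law X (c \o* (\- G) : {RV Q >-> R}))].
Proof.
move=> K; have [f [Xf lf]] := hlc; have [mf f0 _] := Xf.
have f1 := has_density_mass Xf.
have fm : finite_moments f by exact: log_concave_finite_moments.
have mean0 := centered_moment Xf hc.
have n0 : (0 < n)%N by exact: leq_trans hn.
have v0 := second_moment_gt0 mf f0 f1 lf.
have ea := even_power_integral_density Xf fm hev.
have ev := even_power_integral_density Xf fm (n := 2) isT.
have a0 : 0 <= moment f 'X^n.
  by apply: Rintegral_ge0 => x _; rewrite hornerXn mulr_ge0 // exprn_even_ge0.
have [ratio_le ratio_eq] := norm_ratio n0 hev a0 v0 (derangement_ge0 R n) ea ev.
have [le_a eq_a] := centered_moment_le_derangement mf f0 f1 lf mean0 hn hev.
split; first by rewrite ratio_le.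
  by rewrite subfactorialE.
move=> d' T' Q G Gg; rewrite ratio_eq; split=> [/eq_a[c [c0 cs fg]]|[c c0 XG]].
  have law := distribution_rescale Xf Gg c0 fg.
  exists `|c|; first by rewrite normr_gt0.
  have [cp|cn] := leP 0 c; [left|right] => A mA; rewrite (law A mA).
    rewrite (ger0_norm cp) /distribution /pushforward; congr (Q _).
    by apply/seteqP; split=> t /=; rewrite mulrC.
  rewrite (ltr0_norm cn) /distribution /pushforward; congr (Q _).
  by apply/seteqP; split=> t /=; rewrite mulrNN mulrC.
have pow k : ~~ odd k -> moment f 'X^k = c ^+ k * derangement R k.
  move=> ok; apply: EFin_inj; rewrite -(even_power_integral_density Xf fm ok).
  case: XG => /eq_law_even_power -> //.
    exact: even_power_gamma.
  rewrite -(even_power_gamma c Gg ok); apply: eq_integral => t _ /=.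
  by rewrite mulNr exprNn -signr_odd (negbTE ok) mul1r.
rewrite !pow // derangementSS derangement1 derangement0 add0r mul1r mulr1.
by rewrite sqrtr_sqr gtr0_norm.
Qed.
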